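(* Let $X$ and $Y$ be real random variables for which the kernels $h_{F_1}$ and $h_{F_2}$ exist, where $F_1,F_2$ are the distribution functions of $X,Y$. Suppose $\kappa(X,X)<\infty$ and $\kappa(Y,Y)<\infty$. Then $0\le\rho^*(X,Y)\le1$, with $\rho^*(X,Y)=0$ if and only if $X$ and $Y$ are independent, and $\rho^*(X,Y)=1$ if and only if $X$ and $Y$ are almost surely linearly related.
   Context: For a real random variable $Z$ its distribution function is taken in the convention $F(z)=P(Z<z)+\tfrac12P(Z=z)$; no restriction is placed on distributions (continuous, discrete or mixed). With $Z_1,Z_2$ i.i.d. with distribution function $F$, define $$h_F(z_1,z_2)=-\tfrac12E\big(|z_1-z_2|-|z_1-Z_2|-|Z_1-z_2|+|Z_1-Z_2|\big).$$ The kernel $h_F$ is said to exist if $h_F(z_1,z_2)$ is finite for some $(z_1,z_2)\in\mathbb R^2$. For real random variables $X,Y$ with marginal distribution functions $F_1,F_2$ and with $(X_1,Y_1),(X_2,Y_2)$ i.i.d. copies of $(X,Y)$, $$\kappa(X,Y)=E\,h_{F_1}(X_1,X_2)h_{F_2}(Y_1,Y_2),\qquad \rho^*(X,Y)=\frac{\kappa(X,Y)}{\sqrt{\kappa(X,X)\kappa(Y,Y)}}.$$ In particular $\kappa(X,X)=Eh_{F_1}(X_1,X_2)^2$. ''$X$ and $Y$ are almost surely linearly related'' means that one of them is almost surely equal to an affine function of the other. *)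

(* Defs.v *)
From HB Require Import structures.
From mathcomp Require Import all_boot all_order all_algebra.
From mathcomp Require Import all_classical all_reals all_analysis.
Import Order.TTheory GRing.Theory Num.Theory.
Import numFieldNormedType.Exports.

Set Implicit Arguments.
Unset Strict Implicit.
Unset Printing Implicit Defensive.

Local Open Scope classical_set_scope.
Local Open Scope ring_scope.
Local Open Scope ereal_scope.

(* The kernel h_F. The expectation is over i.i.d. Z1, Z2 with distribution
   function F(z) = P(Z < z) + P(Z = z) / 2; since F and the common law mu
   determine each other, the kernel is indexed by mu, and (Z1, Z2) is the pair
   of coordinates under mu \x mu. The expectation is that of the whole
   four-term combination (the single terms need not be integrable), hence
   extended-real valued; it is a [fin_num] exactly when the combination is
   integrable. *)
Definition hker (R : realType) (mu : probability R R) (z1 z2 : R) : \bar R :=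
  - (2^-1)%:E * \int[mu \x mu]_Z
      (`|z1 - z2| - `|z1 - Z.2| - `|Z.1 - z2| + `|Z.1 - Z.2|)%R%:E.

Definition hker_exists (R : realType) (mu : probability R R) : Prop :=
  exists z1 z2 : R, hker mu z1 z2 \is a fin_num.

Section correlation.
Context (d : measure_display) (T : measurableType d) (R : realType).
Variable P : probability T R.
Implicit Types X Y : {RV P >-> R}.

(* The i.i.d. copies (X1, Y1), (X2, Y2) of (X, Y) are (X w.1, Y w.1) and
   (X w.2, Y w.2) for w drawn from P \x P. *)
Definition kappa X Y : \bar R :=
  \int[P \x P]_w (hker (distribution P X) (X w.1) (X w.2) *
                  hker (distribution P Y) (Y w.1) (Y w.2)).

(* Kept in \bar R so that no finiteness of kappa X Y is presupposed; only
   meaningful when kappa X X and kappa Y Y are nonzero. *)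
Definition rho_star X Y : \bar R :=
  kappa X Y / sqrte (kappa X X * kappa Y Y).

Definition independent_RV X Y : Prop :=
  forall A B : set R, measurable A -> measurable B ->
    P ((X @^-1` A) `&` (Y @^-1` B)) = P (X @^-1` A) * P (Y @^-1` B).

(* A slope equal to zero is allowed, as for an arbitrary affine function. *)
Definition as_linearly_related X Y : Prop :=
  (exists a b : R, {ae P, forall w, Y w = (a * X w + b)%R}) \/
  (exists a b : R, {ae P, forall w, X w = (a * Y w + b)%R}).

End correlation.

Arguments kappa {d T R} P X Y.
Arguments rho_star {d T R} P X Y.
Arguments independent_RV {d T R} P X Y.
Arguments as_linearly_related {d T R} P X Y.

(* Main.v *)
Require Import Defs.
From mathcomp Require Import all_boot all_order all_algebra.
From mathcomp Require Import all_classical all_reals all_analysis.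
From mathcomp Require Import measurable_realfun.
From mathcomp Require Import ring lra.
Import Order.TTheory GRing.Theory Num.Theory.
Import numFieldNormedType.Exports.

Set Implicit Arguments.
Unset Strict Implicit.
Unset Printing Implicit Defensive.

Local Open Scope ring_scope.
Local Open Scope ereal_scope.

(** Write 1(x > s) for the indicator of x > s, and attach to a real random
variable X the random field u_s = 1(X > s) - P(X > s), indexed by the level s.
Since |a - b| is the integral over s of (1(a > s) - 1(b > s))^2, polarization
followed by Fubini turns the kernel h_F into the Gram kernel of this field:
h_F(x, y) is the integral over s of (1(x > s) - P(X > s))(1(y > s) - P(X > s))
([hkerE]).  Let v_t be the field of Y and D(s, t) = E u_s v_t
= P(X > s, Y > t) - P(X > s) P(Y > t).  Exchanging the integrals formally,
kappa(X, Y) is the integral over (s, t) of D(s, t)^2.  This explains the whole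
statement: kappa is nonnegative, it vanishes exactly when D does, that is under
independence, and kappa <= sqrt(kappa(X, X) kappa(Y, Y)) is the Cauchy-Schwarz
inequality for two kernels in L^2(P x P).

The exchange is the delicate point, because X need not have a first moment: the
existence of the kernel only makes the integral of (E|u_s|)^2 finite.  This
is enough for Fubini when one of the two kernels is bounded
([integral_field_ker_bounded]), which is the case once its levels are
restricted to a set B of finite measure.  The restricted kernels K_B v then
satisfy E (K u)(K_B v) = int int_B D^2 >= 0 and E (K_B v)^2 <= E (K v)^2, and
Fatou's lemma applied to (K u - K_B v)^2 and to (K u + K_B v)^2 as B
exhausts the line carries to the limit what is needed of the formula:
positivity, and both directions of the criterion for a zero value
([integral_field_ker_mul_ge0], [integral_field_ker_mul_eq0],
[field_cov_ae0]).  From D = 0 almost everywhere one gets D = 0 everywhere by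
right continuity of the tails, and independence from the fact that half-lines
generate the Borel sets ([independent_field_cov]).

If rho* = 1, equality in Cauchy-Schwarz gives h_F1(X1, X2) = c h_F2(Y1, Y2)
almost surely.  The kernels are Lipschitz, so the equality holds for all pairs of
points of the support of the law of (X, Y), including pairs on the diagonal, and
h(x, x) + h(y, y) - 2 h(x, y) = |x - y| shows that the support is the graph of a
similarity between two subsets of the line, hence lies on an affine line
([linear_of_proportional]).  Conversely h scales by |a| under x |-> a x + b
([hker_affine]), which makes the two kernels proportional and the coefficient
equal to 1. *)

(** * Square-integrable functions *)

Section real_integrals.
Context (d : measure_display) (T : measurableType d) (R : realType).

Lemma integrable_of_le (mu : {measure set T -> \bar R}) (f g : T -> R) :
  measurable_fun setT f -> mu.-integrable setT (EFin \o g) ->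
  (forall x, `|f x| <= g x)%R -> mu.-integrable setT (EFin \o f).
Proof.
move=> mf ig fg; apply: (le_integrable measurableT _ _ ig).
  exact/measurable_EFinP.
by move=> x _; rewrite /= lee_fin (le_trans (fg x)) // ler_norm.
Qed.

Lemma integrable_of_bound (P : probability T R) (f : T -> R) (M : R) :
  measurable_fun setT f -> (forall x, `|f x| <= M)%R ->
  P.-integrable setT (EFin \o f).
Proof.
move=> mf fM; apply: (@integrable_of_le _ _ (cst M)) => //.
exact: (finite_measure_integrable_cst P M).
Qed.

Lemma measurable_of_integrable (mu : {measure set T -> \bar R}) (f : T -> R) :
  mu.-integrable setT (EFin \o f) -> measurable_fun setT f.
Proof. by move=> /measurable_int /measurable_EFinP. Qed.

Lemma EFin_Rintegral (mu : {measure set T -> \bar R}) (f : T -> R) :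
  mu.-integrable setT (EFin \o f) ->
  (\int[mu]_x f x)%R%:E = \int[mu]_x (f x)%:E.
Proof. by move=> fi; rewrite fineK //; exact: integrable_fin_num. Qed.

Lemma sqr_integrable_mul (mu : {measure set T -> \bar R}) (f g : T -> R) :
  measurable_fun setT f -> measurable_fun setT g ->
  mu.-integrable setT (fun x => (f x ^+ 2)%:E) ->
  mu.-integrable setT (fun x => (g x ^+ 2)%:E) ->
  mu.-integrable setT (fun x => (f x * g x)%:E).
Proof.
move=> mf mg f2 g2.
apply: (@integrable_of_le _ _ (fun x => f x ^+ 2 + g x ^+ 2)%R).
- exact: measurable_funM.
- exact: (integrableD measurableT f2 g2).
- move=> x; rewrite ler_norml.
  have := sqr_ge0 (f x + g x); have := sqr_ge0 (f x - g x).
  have := sqr_ge0 (f x); have := sqr_ge0 (g x).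
  by move=> ? ? ? ?; apply/andP; split; nra.
Qed.

Lemma sqr_integrableD (mu : {measure set T -> \bar R}) (f g : T -> R) (a : R) :
  measurable_fun setT f -> measurable_fun setT g ->
  mu.-integrable setT (fun x => (f x ^+ 2)%:E) ->
  mu.-integrable setT (fun x => (g x ^+ 2)%:E) ->
  mu.-integrable setT (fun x => ((f x + a * g x) ^+ 2)%:E) /\
  (\int[mu]_x (f x + a * g x) ^+ 2 =
   \int[mu]_x f x ^+ 2 + 2 * a * \int[mu]_x (f x * g x) +
   a ^+ 2 * \int[mu]_x (g x ^+ 2))%R.
Proof.
move=> mf mg f2 g2; have fg := sqr_integrable_mul mf mg f2 g2.
have E x : ((f x + a * g x) ^+ 2 =
    f x ^+ 2 + (2 * a * (f x * g x)) + a ^+ 2 * g x ^+ 2)%R by ring.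
have i1 : mu.-integrable setT (fun x => (2 * a * (f x * g x))%:E).
  exact: (integrableZl measurableT (2 * a)%R fg).
have i2 : mu.-integrable setT (fun x => (a ^+ 2 * g x ^+ 2)%:E).
  exact: (integrableZl measurableT (a ^+ 2)%R g2).
have i3 : mu.-integrable setT (fun x => (f x ^+ 2 + 2 * a * (f x * g x))%:E).
  exact: (integrableD measurableT f2 i1).
split.
  under eq_fun do rewrite E.
  exact: (integrableD measurableT i3 i2).
under eq_Rintegral do rewrite E.
by rewrite RintegralD // RintegralD // !RintegralZl.
Qed.

(** Fatou's lemma, in the form that replaces dominated convergence below: a
uniform second moment bound passes to a pointwise limit. *)
Lemma sqr_integral_le_of_cvg (mu : {measure set T -> \bar R})
    (f_ : nat -> T -> R) (f : T -> R) (C : \bar R) :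
  (forall n, measurable_fun setT (f_ n)) ->
  (forall x, f_ n x @[n --> \oo] --> f x)%classic ->
  (forall n, \int[mu]_x (f_ n x ^+ 2)%:E <= C) ->
  \int[mu]_x (f x ^+ 2)%:E <= C.
Proof.
move=> mf_ f_f f_C.
have c2 x : ((f_ n x ^+ 2)%:E @[n --> \oo] --> (f x ^+ 2)%:E)%classic.
  apply: cvg_EFin; first exact: nearW.
  rewrite /comp /=; under eq_fun do rewrite expr2; rewrite expr2.
  by apply: cvgM; exact: f_f.
have -> : \int[mu]_x (f x ^+ 2)%:E =
    \int[mu]_x limn_einf (fun n => (f_ n x ^+ 2)%:E).
  apply: eq_integral => x _.
  rewrite is_cvg_limn_einfE; last by apply/cvg_ex; exists (f x ^+ 2)%:E.
  by apply/esym/cvg_lim.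
apply: (le_trans (fatou mu measurableT _ _)).
- by move=> n; apply/measurable_EFinP; exact: measurable_funX.
- by move=> n x _; rewrite lee_fin sqr_ge0.
rewrite limn_einf_lim; apply: lime_le; first exact: is_cvg_einfs.
apply: nearW => n; apply: ge_ereal_inf => /=.
by exists (\int[mu]_x (f_ n x ^+ 2)%:E) => //; exists n => /=.
Qed.

End real_integrals.

(** * Gram kernels of random fields *)
Section fields.
Context (d d' : measure_display) (T : measurableType d) (S : measurableType d')
  (R : realType).
Variables (P : probability T R) (nu : {sigma_finite_measure set S -> \bar R}).
Local Notation Q := (P \x P : probability (T * T)%type R).

(** Integrability of [u] on the product [P \x nu] would be too much to ask.  The
third clause makes the Gram kernel finite at every point, the fourth makes it
integrable for [P \x P].  The centered indicators of a heavy-tailed variable can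
satisfy both without being integrable. *)
Definition admissible_field (u : T * S -> R) : Prop :=
  [/\ measurable_fun setT u, forall z, (`|u z| <= 1)%R,
    forall w, nu.-integrable setT (fun s => (u (w, s) ^+ 2)%:E)
  & \int[nu]_s (\int[P]_w `|u (w, s)|%:E) ^+ 2 < +oo].

Definition field_ker (u : T * S -> R) (w : T * T) : R :=
  (\int[nu]_s (u (w.1, s) * u (w.2, s)))%R.

Definition field_cov (u v : T * S -> R) (s t : S) : R :=
  (\int[P]_w (u (w, s) * v (w, t)))%R.

Lemma measurable_slice1 (u : T * S -> R) w :
  measurable_fun setT u -> measurable_fun setT (fun s => u (w, s)).
Proof. by move=> mu; apply: (measurableT_comp mu); exact: pair1_measurable. Qed.

Lemma measurable_slice2 (u : T * S -> R) s :
  measurable_fun setT u -> measurable_fun setT (fun w => u (w, s)).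
Proof. by move=> mu; apply: (measurableT_comp mu); exact: pair2_measurable. Qed.

Lemma field_mul_integrable (u : T * S -> R) w w' : admissible_field u ->
  nu.-integrable setT (fun s => (u (w, s) * u (w', s))%:E).
Proof.
move=> [mu _ u2 _].
by apply: sqr_integrable_mul => //; exact: measurable_slice1.
Qed.

Lemma ge0_integral_prod_mul (a b : T -> \bar R) :
  measurable_fun setT a -> measurable_fun setT b ->
  (forall w, 0 <= a w) -> (forall w, 0 <= b w) ->
  \int[Q]_w (a w.1 * b w.2) = (\int[P]_w a w) * (\int[P]_w b w).
Proof.
move=> ma mb a0 b0; rewrite fubini_tonelli1 //=; last 2 first.
- apply: emeasurable_funM.
    exact: (measurableT_comp ma measurable_fst).
  exact: (measurableT_comp mb measurable_snd).
- by move=> x; rewrite mule_ge0.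
rewrite /fubini_F /= -ge0_integralZr //; last exact: integral_ge0.
by apply: eq_integral => w _; rewrite ge0_integralZl.
Qed.

Lemma integral_prod_mul (a b : T -> R) (M : R) :
  measurable_fun setT a -> measurable_fun setT b ->
  (forall w, `|a w| <= M)%R -> (forall w, `|b w| <= M)%R ->
  \int[Q]_w (a w.1 * b w.2)%:E =
  ((\int[P]_w a w) * (\int[P]_w b w))%R%:E.
Proof.
move=> ma mb aM bM.
have ia := integrable_of_bound P ma aM.
have ib := integrable_of_bound P mb bM.
rewrite -integral12_prod_meas1; last first.
  apply: (integrable_of_bound (P \x P) (M := M * M)).
    apply: measurable_funM.
      exact: (measurableT_comp ma measurable_fst).
    exact: (measurableT_comp mb measurable_snd).
  by move=> x; rewrite normrM ler_pM.
transitivity (\int[P]_w ((a w)%:E * (\int[P]_w b w)%R%:E)).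
  apply: eq_integral => w _; rewrite EFin_Rintegral //.
  by rewrite /fubini_F /=; under eq_integral do rewrite EFinM; rewrite integralZl.
by rewrite integralZr // EFinM -EFin_Rintegral.
Qed.

(** The integral over [P \x P] of the absolute value of [u (w, s) * u (w', s)] is
the square of [E |u_s|], so that the last clause of [admissible_field] is exactly
what Fubini requires against a bounded function of the pair [(w, w')]. *)
Section fubini_kernel.
Variables (u : T * S -> R) (f : T * T -> R) (M : R).
Hypotheses (uA : admissible_field u) (mf : measurable_fun setT f).
Hypothesis fM : forall w, (`|f w| <= M)%R.

Let G (z : (T * T) * S) : R := (u (z.1.1, z.2) * u (z.1.2, z.2) * f z.1)%R.

Let mG : measurable_fun setT G.
Proof.
have [mu _ _ _] := uA.
apply: measurable_funM; last exact: (measurableT_comp mf measurable_fst).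
apply: measurable_funM; apply: (measurableT_comp mu).
  apply: measurable_fun_pair; last exact: measurable_snd.
  exact: (measurableT_comp measurable_fst measurable_fst).
apply: measurable_fun_pair; last exact: measurable_snd.
exact: (measurableT_comp measurable_snd measurable_fst).
Qed.

Let iG : (Q \x nu).-integrable setT (EFin \o G).
Proof.
have [mu u1 _ u2] := uA.
have M0 : (0 <= M)%R by apply: le_trans (fM (point, point)).
have mG' : measurable_fun setT (EFin \o G) by exact/measurable_EFinP.
apply: (integrable21ltyP Q nu mG').2.
have mI : measurable_fun setT (fun s => \int[P]_w `|u (w, s)|%:E).
  apply: (measurable_fun_fubini_tonelli_G (fun z => `|u z|%:E)) => //.
  by apply/measurable_EFinP; exact: measurableT_comp.
have mI2 : measurable_fun setT (fun s => (\int[P]_w `|u (w, s)|%:E) ^+ 2).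
  by under eq_fun do rewrite expe2; exact: emeasurable_funM.
apply: (@le_lt_trans _ _
    (\int[nu]_s (M%:E * (\int[P]_w `|u (w, s)|%:E) ^+ 2))); last first.
  rewrite ge0_integralZl //.
  - by rewrite lte_mul_pinfty // ge0_fin_numE // lee_fin.
  - by move=> s _; rewrite expe_ge0 // integral_ge0.
apply: ge0_le_integral => //.
- by move=> s _; exact: integral_ge0.
- apply: (measurable_fun_fubini_tonelli_G (fun z => `|(G z)%:E|)) => //.
  by apply: measurableT_comp => //; exact/measurable_EFinP.
- exact: emeasurable_funM.
move=> s _.
have ms : measurable_fun setT (fun w => `|u (w, s)|%:E).
  by apply/measurable_EFinP; apply: measurableT_comp => //; exact: measurable_slice2.
have mms : measurable_fun setT (fun w : T * T => `|u (w.1, s)|%:E * `|u (w.2, s)|%:E).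
  apply: emeasurable_funM.
    exact: (measurableT_comp ms measurable_fst).
  exact: (measurableT_comp ms measurable_snd).
rewrite expe2 -ge0_integral_prod_mul // -ge0_integralZl //.
apply: ge0_le_integral => //.
- apply: measurableT_comp => //; apply/measurable_EFinP.
  by apply: (measurableT_comp mG); exact: pair2_measurable.
- exact: emeasurable_funM.
move=> w _; rewrite /G /= lee_fin !normrM mulrC ler_wpM2r //.
Qed.

Let fubini_FE w : fubini_F nu (EFin \o G) w = (field_ker u w * f w)%:E.
Proof.
have iu := field_mul_integrable w.1 w.2 uA.
rewrite /fubini_F /= /G /=; under eq_integral do rewrite EFinM.
by rewrite integralZr // EFinM /field_ker EFin_Rintegral.
Qed.

Lemma field_ker_mul_integrable :
  Q.-integrable setT (fun w => (field_ker u w * f w)%:E).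
Proof.
have := @integrable_fubini_F _ _ _ _ _ Q nu _ iG.
by apply: eq_integrable => // w _; rewrite fubini_FE.
Qed.

Lemma integral_field_ker_mul :
  \int[Q]_w (field_ker u w * f w)%:E =
  \int[nu]_s \int[Q]_w (u (w.1, s) * u (w.2, s) * f w)%:E.
Proof.
rewrite -(@Fubini _ _ _ _ _ Q nu _ iG) /=.
by apply: eq_integral => w _; rewrite -fubini_FE.
Qed.

End fubini_kernel.

Lemma measurable_field_ker (u : T * S -> R) :
  admissible_field u -> measurable_fun setT (field_ker u).
Proof.
move=> uA; apply: (measurable_of_integrable (mu := Q)).
have := @field_ker_mul_integrable u (cst 1%R) 1 uA.
have -> : (fun w => (field_ker u w * cst 1 w)%:E) = EFin \o field_ker u.
  by apply/funext => w /=; rewrite mulr1.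
by apply=> // w; rewrite /cst normr1.
Qed.

Lemma measurable_field_product (u : T * S -> R) s :
  measurable_fun setT u ->
  measurable_fun setT (fun w : T * T => u (w.1, s) * u (w.2, s))%R.
Proof.
move=> mu; have mus := measurable_slice2 s mu.
by apply: measurable_funM; exact: (measurableT_comp mus).
Qed.

(** Fubini is used twice: since the kernel of [v] is bounded, the integral
over [s] can be taken last; then, since [u_s \x u_s] is bounded, so can the
integral over [t].  What remains inside is the expectation of a product of two
independent factors with the same law, hence a square. *)
Lemma integral_field_ker_bounded (u v : T * S -> R) M :
  admissible_field u -> admissible_field v ->
  (forall w, `|field_ker v w| <= M)%R ->
  \int[Q]_w (field_ker u w * field_ker v w)%:E =
  \int[nu]_s \int[nu]_t (field_cov u v s t ^+ 2)%:E.
Proof.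
move=> uA vA vM; have [mu u1 _ _] := uA; have [mv v1 _ _] := vA.
have mkv := measurable_field_ker vA.
rewrite (integral_field_ker_mul uA mkv vM).
apply: eq_integral => s _.
have mus := measurable_slice2 s mu.
under eq_integral do rewrite mulrC.
rewrite (@integral_field_ker_mul v (fun w => (u (w.1, s) * u (w.2, s))%R) 1) //;
  last 2 first.
- exact: measurable_field_product.
- by move=> w; rewrite normrM mulr_ile1.
apply: eq_integral => t _.
have mvt := measurable_slice2 t mv.
rewrite expr2 -(@integral_prod_mul _ _ 1).
- by apply: eq_integral => w _; congr EFin; ring.
- exact: measurable_funM.
- exact: measurable_funM.
- by move=> w; rewrite normrM mulr_ile1.
- by move=> w; rewrite normrM mulr_ile1.
Qed.

(** Restricting the levels to [B] is done by multiplication, so that the result is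
again a field on the same index space and its kernel needs no separate theory. *)
Definition field_restr (u : T * S -> R) (B : set S) (z : T * S) : R :=
  (u z * \1_B z.2)%R.

Lemma indic_sqr (B : set S) s : ((\1_B s : R) * \1_B s = \1_B s)%R.
Proof. by rewrite indicE; case: (_ \in _); rewrite ?mulr1 ?mulr0. Qed.

Lemma normr_indic_le1 (B : set S) s : (`|\1_B s : R| <= 1)%R.
Proof. by rewrite indicE; case: (_ \in _); rewrite ?normr1 ?normr0. Qed.

Lemma admissible_restr (u : T * S -> R) (B : set S) : measurable B ->
  admissible_field u -> admissible_field (field_restr u B).
Proof.
move=> mB [mu u1 u2 u3].
have mr : measurable_fun setT (field_restr u B).
  apply: measurable_funM => //.
  exact: (measurableT_comp (measurable_indic mB) measurable_snd).
have le_r z : (`|field_restr u B z| <= `|u z|)%R.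
  by rewrite normrM ler_piMr // normr_indic_le1.
split; first exact: mr.
- by move=> z; exact: le_trans (le_r z) (u1 z).
- move=> w; apply: (integrable_of_le (g := fun s => (u (w, s) ^+ 2)%R)); last 1 first.
  - by move=> s; rewrite normrX -[leRHS]real_normK ?num_real // lerXn2r ?nnegrE.
  - by apply: measurable_funX; exact: measurable_slice1.
  - exact: u2.
apply: le_lt_trans u3.
have mI (f : T * S -> R) : measurable_fun setT f ->
    measurable_fun setT (fun s => (\int[P]_w `|f (w, s)|%:E) ^+ 2).
  move=> mf; under eq_fun do rewrite expe2.
  have : measurable_fun setT (fun s => \int[P]_w `|f (w, s)|%:E).
    apply: (measurable_fun_fubini_tonelli_G (fun z => `|f z|%:E)) => //.
    by apply/measurable_EFinP; exact: measurableT_comp.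
  by move=> ?; exact: emeasurable_funM.
apply: ge0_le_integral; [exact: measurableT| |exact: mI|exact: mI|].
  by move=> s _; rewrite expe_ge0 // integral_ge0.
have mn (f : T * S -> R) s : measurable_fun setT f ->
    measurable_fun setT (fun w => `|f (w, s)|%:E).
  move=> mf; apply/measurable_EFinP; apply: measurableT_comp => //.
  exact: measurable_slice2.
move=> s _; rewrite !expe2; apply: lee_pmul; rewrite ?integral_ge0 //.
  apply: ge0_le_integral => //; [exact: mn|exact: mn|].
  by move=> w _; rewrite lee_fin.
apply: ge0_le_integral => //; [exact: mn|exact: mn|].
by move=> w _; rewrite lee_fin.
Qed.

Lemma field_ker_restr (u : T * S -> R) (B : set S) w : measurable B ->
  field_ker (field_restr u B) w = (\int[nu]_(s in B) (u (w.1, s) * u (w.2, s)))%R.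
Proof.
move=> mB; rewrite /field_ker [RHS]Rintegral_mkcond; apply: eq_Rintegral => s _.
rewrite /field_restr patchE /= indicE.
by case: (s \in B); rewrite ?mulr1 // !mulr0.
Qed.

Lemma field_ker_restr_le (u : T * S -> R) (B : set S) w :
  measurable B -> nu B < +oo -> admissible_field u ->
  (`|field_ker (field_restr u B) w| <= fine (nu B))%R.
Proof.
move=> mB fB uA; rewrite field_ker_restr //.
have iu := field_mul_integrable w.1 w.2 uA.
have iB : nu.-integrable B (EFin \o (fun s => u (w.1, s) * u (w.2, s))%R).
  exact: (integrableS measurableT).
apply: (le_trans (le_normr_Rintegral _ _)) => //.
have [_ u1 _ _] := uA.
rewrite -[leRHS]mul1r -Rintegral_cst //; apply: le_Rintegral => //.
- exact: (integrable_norm iB).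
- apply/integrableP; split; first exact: measurable_cst.
  by rewrite /= integral_cst // normr1 mul1e.
- by move=> s _; rewrite normrM mulr_ile1.
Qed.

Lemma field_ker_restrC (u : T * S -> R) (B : set S) w :
  measurable B -> admissible_field u ->
  (field_ker (field_restr u B) w + field_ker (field_restr u (~` B)%classic) w =
   field_ker u w)%R.
Proof.
move=> mB uA; have mC := measurableC mB.
rewrite /field_ker -RintegralD //; first last.
- exact: (field_mul_integrable _ _ (admissible_restr mC uA)).
- exact: (field_mul_integrable _ _ (admissible_restr mB uA)).
apply: eq_Rintegral => s _; rewrite /field_restr /= !indicE in_setC.
by case: (s \in B) => /=; ring.
Qed.

Lemma integral_field_ker_restr_ge0 (u v : T * S -> R) (B : set S) :
  measurable B -> nu B < +oo -> admissible_field u -> admissible_field v ->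
  (0 <= \int[Q]_w (field_ker u w * field_ker (field_restr v B) w))%R.
Proof.
move=> mB fB uA vA; have vBA := admissible_restr mB vA.
rewrite /Rintegral (integral_field_ker_bounded uA vBA (M := fine (nu B))).
  apply: fine_ge0; apply: integral_ge0 => s _; apply: integral_ge0 => t _.
  by rewrite lee_fin sqr_ge0.
by move=> w; exact: field_ker_restr_le.
Qed.

Definition sqr_integrable_ker (u : T * S -> R) : Prop :=
  admissible_field u /\ Q.-integrable setT (fun w => (field_ker u w ^+ 2)%:E).

Lemma sqr_integrable_restr_finite (u : T * S -> R) (B : set S) :
  measurable B -> nu B < +oo -> admissible_field u ->
  sqr_integrable_ker (field_restr u B).
Proof.
move=> mB fB uA; have uBA := admissible_restr mB uA; split => //.
apply: (integrable_of_bound _ (M := fine (nu B) ^+ 2)).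
  by apply: measurable_funX; exact: measurable_field_ker.
move=> w; rewrite normrX lerXn2r ?nnegrE //; first exact: fine_ge0.
exact: field_ker_restr_le.
Qed.

Lemma field_ker_mul_integrable2 (u v : T * S -> R) :
  sqr_integrable_ker u -> sqr_integrable_ker v ->
  Q.-integrable setT (fun w => (field_ker u w * field_ker v w)%:E).
Proof.
move=> [uA u2] [vA v2].
by apply: sqr_integrable_mul => //; exact: measurable_field_ker.
Qed.

Lemma sqr_integrable_restrC (u : T * S -> R) (B : set S) :
  measurable B -> nu B < +oo -> sqr_integrable_ker u ->
  sqr_integrable_ker (field_restr u (~` B)%classic).
Proof.
move=> mB fB [uA u2]; have uCA := admissible_restr (measurableC mB) uA.
split => //.
have [uBA uB2] := sqr_integrable_restr_finite mB fB uA.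
have [+ _] := sqr_integrableD (-1)%R (measurable_field_ker uA)
  (measurable_field_ker uBA) u2 uB2.
apply: eq_integrable => // w _; congr EFin.
by rewrite -(field_ker_restrC w mB uA); congr (_ ^+ 2)%R; ring.
Qed.

Lemma integral_field_ker_split (u v : T * S -> R) (B : set S) :
  measurable B -> nu B < +oo -> sqr_integrable_ker u -> sqr_integrable_ker v ->
  (\int[Q]_w (field_ker u w * field_ker v w) =
   \int[Q]_w (field_ker u w * field_ker (field_restr v B) w) +
   \int[Q]_w (field_ker u w * field_ker (field_restr v (~` B)%classic) w))%R.
Proof.
move=> mB fB ui vi; have [uA _] := ui; have [vA _] := vi.
have vBi := sqr_integrable_restr_finite mB fB vA.
have vCi := sqr_integrable_restrC mB fB vi.
rewrite -RintegralD //; [|exact: field_ker_mul_integrable2..].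
by apply: eq_Rintegral => w _; rewrite -(field_ker_restrC w mB vA) mulrDr.
Qed.

(** With [C] the complement of [B], [K u = K_B u + K_C u] and the cross term
[E (K_B u) (K_C u)] is nonnegative although the two kernels are not orthogonal;
expanding the square of [K u - K_B u] gives the inequality. *)
Lemma sqr_field_ker_restr_le (u : T * S -> R) (B : set S) :
  measurable B -> nu B < +oo -> sqr_integrable_ker u ->
  (\int[Q]_w field_ker (field_restr u B) w ^+ 2 <=
   \int[Q]_w field_ker u w ^+ 2)%R.
Proof.
move=> mB fB ui; have [uA u2] := ui.
have uBi := sqr_integrable_restr_finite mB fB uA; have [uBA uB2] := uBi.
have uCi := sqr_integrable_restrC mB fB ui; have [uCA uC2] := uCi.
have [_ E] := sqr_integrableD (-1)%R (measurable_field_ker uA)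
  (measurable_field_ker uBA) u2 uB2.
have : (0 <= \int[Q]_w (field_ker u w + -1 * field_ker (field_restr u B) w) ^+ 2)%R.
  by apply: Rintegral_ge0 => w _; rewrite sqr_ge0.
rewrite E.
have := integral_field_ker_split mB fB uBi ui.
have := integral_field_ker_restr_ge0 mB fB uCA uA.
have -> : (\int[Q]_w (field_ker (field_restr u B) w * field_ker (field_restr u B) w) =
          \int[Q]_w (field_ker (field_restr u B) w ^+ 2))%R by [].
have -> : (\int[Q]_w (field_ker (field_restr u (~` B)%classic) w * field_ker (field_restr u B) w) =
          \int[Q]_w (field_ker (field_restr u B) w * field_ker (field_restr u (~` B)%classic) w))%R.
  by apply: eq_Rintegral => w _; rewrite mulrC.
have -> : (\int[Q]_w (field_ker (field_restr u B) w * field_ker u w) =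
          \int[Q]_w (field_ker u w * field_ker (field_restr u B) w))%R.
  by apply: eq_Rintegral => w _; rewrite mulrC.
move: (\int[Q]_w (field_ker u w * _))%R (\int[Q]_w (_ * _))%R.
move: (\int[Q]_w _ ^+ 2)%R (\int[Q]_w _ ^+ 2)%R => a b c e.
clear E uA u2 uBi uBA uB2 uCi uCA uC2 ui mB fB; lra.
Qed.

Lemma field_ker_restr_cvg (u : T * S -> R) (B : nat -> set S) w :
  (forall n, measurable (B n)) -> {homo B : n m / (n <= m)%N >-> (n <= m)%O} ->
  (\bigcup_n B n = setT)%classic -> admissible_field u ->
  (field_ker (field_restr u (B n)) w @[n --> \oo] --> field_ker u w)%classic.
Proof.
move=> mB ndB UB uA; have [mu _ _ _] := uA.
have iu := field_mul_integrable w.1 w.2 uA.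
have muu : measurable_fun setT (fun s => u (w.1, s) * u (w.2, s))%R.
  exact: (measurable_of_integrable iu).
have iB n := field_mul_integrable w.1 w.2 (admissible_restr (mB n) uA).
have [] := @dominated_convergence _ _ _ nu setT measurableT
  (fun n s => (field_restr u (B n) (w.1, s) * field_restr u (B n) (w.2, s))%:E)
  (fun s => (u (w.1, s) * u (w.2, s))%:E)
  (fun s => `|(u (w.1, s) * u (w.2, s))%:E|).
- by move=> n; exact: measurable_int (iB n).
- exact: measurable_int iu.
- apply: aeW => s _; apply/cvg_EFin; first exact: nearW.
  have [n _ Bns] : (\bigcup_n B n)%classic s by rewrite UB.
  apply: cvg_near_cst; near=> m; rewrite /= /field_restr /= indicE mem_set.
    by rewrite !mulr1.
  have nm : (n <= m)%N by near: m; exact: nbhs_infty_ge.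
  by move: nm => /ndB /subsetPset; apply.
- exact: integrable_abse.
- apply: aeW => s n _; rewrite /= lee_fin /field_restr /=.
  by rewrite mulrACA indic_sqr normrM ler_piMr // normr_indic_le1.
move=> _ _ H; apply/fine_cvg; rewrite /field_ker.
rewrite fineK; first exact: H.
exact: (integrable_fin_num measurableT iu).
Unshelve. all: by end_near. Qed.

Lemma sigma_finite_exhaustion : exists B : nat -> set S,
  [/\ (\bigcup_n B n = setT)%classic,
     {homo B : n m / (n <= m)%N >-> (n <= m)%O},
     forall n, measurable (B n) & forall n, nu (B n) < +oo].
Proof.
have /sigma_finiteP[B [UB ndB mB]] := sigma_finiteT nu.
by exists B; split => // n; have [] := mB n.
Qed.

(** If [E (K u + a K_B v)^2 <= E (K u)^2 + E (K v)^2] for all [B] of finite measure,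
then Fatou's lemma gives the same bound for [K u + a K v], which forces the sign of
the cross term.  It is used with [a = -1] and with [a = 1]. *)
Lemma sqr_field_ker_add_le (u v : T * S -> R) (a : R) :
  sqr_integrable_ker u -> sqr_integrable_ker v -> (a ^+ 2 = 1)%R ->
  (forall B, measurable B -> nu B < +oo ->
    (a * \int[Q]_w (field_ker u w * field_ker (field_restr v B) w) <= 0)%R) ->
  (a * \int[Q]_w (field_ker u w * field_ker v w) <= 0)%R.
Proof.
move=> ui vi a1 H; have [uA u2] := ui; have [vA v2] := vi.
have [B [UB ndB mB fB]] := sigma_finite_exhaustion.
have mku := measurable_field_ker uA; have mkv := measurable_field_ker vA.
have [iuv Euv] := sqr_integrableD a mku mkv u2 v2.
pose c := (\int[Q]_w field_ker u w ^+ 2 + \int[Q]_w field_ker v w ^+ 2)%R.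
have : \int[Q]_w ((field_ker u w + a * field_ker v w) ^+ 2)%:E <= c%:E.
  apply: (sqr_integral_le_of_cvg (f_ := fun n w =>
      (field_ker u w + a * field_ker (field_restr v (B n)) w)%R)).
  - move=> n; apply: measurable_funD => //; apply: measurable_funM => //.
    exact: measurable_field_ker (admissible_restr _ _).
  - move=> w; apply: cvgD; first exact: cvg_cst.
    by apply: cvgM; [exact: cvg_cst|exact: field_ker_restr_cvg].
  move=> n; have vBi := sqr_integrable_restr_finite (mB n) (fB n) vA.
  have [vBA vB2] := vBi.
  have [i E] := sqr_integrableD a mku (measurable_field_ker vBA) u2 vB2.
  rewrite -EFin_Rintegral // lee_fin E a1.
  have := H _ (mB n) (fB n).
  have := sqr_field_ker_restr_le (mB n) (fB n) vi; rewrite /c => le1 le2.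
  rewrite mul1r -mulrA; apply: lerD le1.
  by rewrite gerDl pmulr_rle0.
rewrite -EFin_Rintegral // lee_fin Euv a1 /c mul1r lerD2r gerDl -mulrA.
by rewrite pmulr_rle0.
Qed.

Theorem integral_field_ker_mul_ge0 (u v : T * S -> R) :
  sqr_integrable_ker u -> sqr_integrable_ker v ->
  (0 <= \int[Q]_w (field_ker u w * field_ker v w))%R.
Proof.
move=> ui vi; have [uA _] := ui; have [vA _] := vi.
rewrite -oppr_le0 -mulN1r; apply: sqr_field_ker_add_le => //.
  by rewrite sqrrN expr1n.
move=> B mB fB; rewrite mulN1r oppr_le0.
exact: integral_field_ker_restr_ge0.
Qed.

Lemma field_cov_restr (u v : T * S -> R) (B : set S) s t :
  admissible_field u -> admissible_field v -> measurable B ->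
  field_cov u (field_restr v B) s t = (field_cov u v s t * \1_B t)%R.
Proof.
move=> [mu u1 _ _] [mv v1 _ _] mB; rewrite /field_cov -RintegralZr //.
  by apply: eq_Rintegral => w _; rewrite /field_restr mulrA.
apply: (integrable_of_bound P (M := 1)).
  by apply: measurable_funM; exact: measurable_slice2.
by move=> w; rewrite normrM mulr_ile1.
Qed.

Theorem integral_field_ker_mul_eq0 (u v : T * S -> R) :
  sqr_integrable_ker u -> sqr_integrable_ker v ->
  (forall s t, field_cov u v s t = 0)%R ->
  (\int[Q]_w (field_ker u w * field_ker v w) = 0)%R.
Proof.
move=> ui vi D0; have [uA _] := ui; have [vA _] := vi.
apply/eqP; rewrite eq_le integral_field_ker_mul_ge0 // andbT.
rewrite -[leLHS]mul1r; apply: sqr_field_ker_add_le => //.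
  by rewrite expr1n.
move=> B mB fB; rewrite mul1r /Rintegral.
rewrite (integral_field_ker_bounded uA (admissible_restr mB vA) (M := fine (nu B))).
  rewrite integral0_eq // => s _; rewrite integral0_eq // => t _.
  by rewrite field_cov_restr // D0 mul0r expr0n.
by move=> w; exact: field_ker_restr_le.
Qed.

Lemma measurable_field_cov (u v : T * S -> R) :
  admissible_field u -> admissible_field v ->
  measurable_fun setT (fun z : S * S => field_cov u v z.1 z.2).
Proof.
move=> [mu _ _ _] [mv _ _ _].
pose f (z : (S * S) * T) : \bar R := (u (z.2, z.1.1) * v (z.2, z.1.2))%:E.
have mf : measurable_fun setT f.
  apply/measurable_EFinP; apply: measurable_funM.
    apply: (measurableT_comp mu); apply: measurable_fun_pair => //.
    exact: (measurableT_comp measurable_fst measurable_fst).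
  apply: (measurableT_comp mv); apply: measurable_fun_pair => //.
  exact: (measurableT_comp measurable_snd measurable_fst).
apply: (measurableT_comp (f := fine)) => //.
have -> : (fun z : S * S => \int[P]_w (u (w, z.1) * v (w, z.2))%:E) =
    (fubini_F P f^\+ \- fubini_F P f^\-).
  apply/funext => z; rewrite integralE /fubini_F /=.
  by congr (_ - _); apply: eq_integral => w _; rewrite ?funeposE ?funenegE.
apply: emeasurable_funB.
  by apply: (measurable_fun_fubini_tonelli_F f^\+); first exact: measurable_funepos.
by apply: (measurable_fun_fubini_tonelli_F f^\-); first exact: measurable_funeneg.
Qed.

(** By [integral_field_ker_split], a zero integral is the sum of two nonnegative
terms, one of which is the integral of the squared covariance over levels [t] in
[B]. *)
Theorem field_cov_ae0 (u v : T * S -> R) :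
  sqr_integrable_ker u -> sqr_integrable_ker v ->
  (\int[Q]_w (field_ker u w * field_ker v w) = 0)%R ->
  {ae nu, forall s, {ae nu, forall t, field_cov u v s t = 0%R}}.
Proof.
move=> ui vi k0; have [uA _] := ui; have [vA _] := vi.
have [B [UB ndB mB fB]] := sigma_finite_exhaustion.
have mD := measurable_field_cov uA vA.
have mD2 : measurable_fun setT (fun z : S * S => (field_cov u v z.1 z.2 ^+ 2)%:E).
  by apply/measurable_EFinP; exact: measurable_funX.
pose DB n (z : S * S) := ((field_cov u v z.1 z.2 * \1_(B n) z.2) ^+ 2)%:E.
have mDB n : measurable_fun setT (DB n).
  apply/measurable_EFinP; apply: measurable_funX; apply: measurable_funM => //.
  by apply: (measurableT_comp (measurable_indic _) measurable_snd).
have DB0 n z : 0 <= DB n z by rewrite lee_fin sqr_ge0.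
have H n : {ae nu, forall s, {ae nu, forall t, DB n (s, t) = 0}}.
  have I0 : \int[nu]_s \int[nu]_t DB n (s, t) = 0.
    have vBi := sqr_integrable_restr_finite (mB n) (fB n) vA.
    have vCi := sqr_integrable_restrC (mB n) (fB n) vi.
    have kn0 : (\int[Q]_w (field_ker u w * field_ker (field_restr v (B n)) w) = 0)%R.
      have := integral_field_ker_split (mB n) (fB n) ui vi.
      have := integral_field_ker_mul_ge0 ui vBi.
      have := integral_field_ker_mul_ge0 ui vCi.
      rewrite k0; move: (\int[Q]_w _)%R (\int[Q]_w _)%R => p q; lra.
    have vBA : admissible_field (field_restr v (B n)) by case: vBi.
    have := integral_field_ker_bounded uA vBA
      (fun w => field_ker_restr_le w (mB n) (fB n) vA).
    rewrite -EFin_Rintegral; last exact: field_ker_mul_integrable2.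
    rewrite kn0 => e; transitivity (0%:E : \bar R) => //.
    rewrite e; apply: eq_integral => s _; apply: eq_integral => t _.
    by rewrite field_cov_restr.
  have mF : measurable_fun setT (fun s => \int[nu]_t DB n (s, t)).
    exact: (measurable_fun_fubini_tonelli_F (DB n)).
  have := (ae_eq_integral_abs nu measurableT mF).1.
  under eq_integral do rewrite gee0_abs ?integral_ge0 //.
  move=> /(_ I0); apply: filterS => s /= /(_ I) Is.
  have mFs : measurable_fun setT (fun t => DB n (s, t)).
    by apply: (measurableT_comp (mDB n)); exact: pair1_measurable.
  have := (ae_eq_integral_abs nu measurableT mFs).1.
  under eq_integral do rewrite gee0_abs //.
  by move=> /(_ Is); apply: filterS => t /= /(_ I).
have := ae_foralln H; apply: filterS => s /ae_foralln.
apply: filterS => t Ht.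
have [n _ Bnt] : (\bigcup_n B n)%classic t by rewrite UB.
have := Ht n; rewrite /DB /= indicE mem_set // mulr1 => -[].
by move=> /eqP; rewrite sqrf_eq0 => /eqP.
Qed.
End fields.

(** * The level representation of the distance *)
Section step_functions.
Context (R : realType).
Local Notation lambda := (@lebesgue_measure R).
Implicit Types a b x y s : R.

Definition step x s : R := ((s < x)%R%:R)%R.

Lemma measurable_step (d : measure_display) (T : measurableType d)
    (f g : T -> R) : measurable_fun setT f -> measurable_fun setT g ->
  measurable_fun setT (fun w => step (f w) (g w)).
Proof.
move=> mf mg; have mgf := measurable_fun_ltr mg mf.
have mA : measurable [set w | (g w < f w)%R].
  have := mgf measurableT [set true]%classic (I : measurable [set true]%classic).
  by rewrite setTI; congr measurable; apply/seteqP; split => w.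
have -> : (fun w => step (f w) (g w)) = \1_[set w | (g w < f w)%R].
  by apply/funext => w; rewrite indicE mem_setE.
exact: measurable_indic.
Qed.

Lemma measurable_step_level x : measurable_fun setT (step x).
Proof. by apply: measurable_step => //; exact: measurable_cst. Qed.

Lemma measurable_step_point s : measurable_fun setT (step ^~ s).
Proof. by apply: measurable_step => //; exact: measurable_cst. Qed.

Lemma step_ge0 x s : (0 <= step x s)%R. Proof. exact: ler0n. Qed.

Lemma step_le1 x s : (step x s <= 1)%R.
Proof. by rewrite /step; case: (s < x)%R. Qed.

Lemma normr_stepB_le1 x y s : (`|step x s - step y s| <= 1)%R.
Proof.
by rewrite /step; case: (s < x)%R; case: (s < y)%R;
  rewrite ?subrr ?subr0 ?sub0r ?normrN ?normr0 ?normr1.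
Qed.

Lemma step_mono x y s : (x <= y)%R -> (step x s <= step y s)%R.
Proof.
move=> xy; rewrite /step; case sx : (s < x)%R; last exact: ler0n.
by rewrite (lt_le_trans sx xy).
Qed.

Lemma normr_stepB x y s : (`|step x s - step y s| = (step x s - step y s) ^+ 2)%R.
Proof.
by rewrite /step; case: (s < x)%R; case: (s < y)%R;
  rewrite ?subrr ?subr0 ?sub0r ?normrN ?normr0 ?normr1 ?expr0n ?sqrrN ?expr1n.
Qed.

Lemma stepB_sgr x y s :
  (step x s - step y s = Num.sg (x - y) * `|step x s - step y s|)%R.
Proof.
have [xy|xy|->] := ltgtP x y; last by rewrite !subrr normr0 mulr0.
- rewrite ltr0_sg ?subr_lt0 // mulN1r ler0_norm ?opprK // subr_le0.
  exact: step_mono (ltW xy).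
- by rewrite gtr0_sg ?subr_gt0 // mul1r ger0_norm // subr_ge0 step_mono // ltW.
Qed.

(** The squared difference is the indicator of the interval between [a] and [b]. *)
Lemma integral_stepB_sqr a b :
  \int[lambda]_s ((step a s - step b s) ^+ 2)%:E = `|a - b|%:E.
Proof.
wlog ba : a b / (b <= a)%R => [H|].
  have [/H//|/ltW /H] := leP b a; rewrite distrC => <-.
  by apply: eq_integral => s _; congr EFin; ring.
transitivity (\int[lambda]_s (\1_(`[b, a[%classic) s : R)%:E).
  apply: eq_integral => s _; congr EFin; rewrite indicE /step mem_setE in_itv /=.
  have [sb|sb] := ltP s b => /=.
    by rewrite (lt_le_trans sb ba) subrr expr0n.
  by rewrite subr0; case: (s < a)%R; rewrite ?expr1n ?expr0n.
rewrite integral_indic //= setIT lebesgue_measure_itv /= lte_fin.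
rewrite ger0_norm ?subr_ge0 //.
by case: ltP => // ab; rewrite (le_anti (introT andP (conj ab ba))) subrr.
Qed.

Lemma integrable_stepB_sqr a b :
  lambda.-integrable setT (fun s => ((step a s - step b s) ^+ 2)%:E).
Proof.
apply/integrableP; split.
  apply/measurable_EFinP; apply: measurable_funX.
  by apply: measurable_funB; exact: measurable_step_level.
under eq_integral do rewrite gee0_abs ?lee_fin ?sqr_ge0 //.
by rewrite integral_stepB_sqr ltry.
Qed.

Lemma Rintegral_stepB_sqr a b :
  (\int[lambda]_s (step a s - step b s) ^+ 2 = `|a - b|)%R.
Proof. by rewrite /Rintegral integral_stepB_sqr. Qed.

Lemma integrable_stepB_mul z1 a z2 b : lambda.-integrable setT
  (fun s => ((step z1 s - step a s) * (step z2 s - step b s))%:E).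
Proof.
apply: sqr_integrable_mul; try exact: integrable_stepB_sqr.
- by apply: measurable_funB; exact: measurable_step_level.
- by apply: measurable_funB; exact: measurable_step_level.
Qed.

Lemma Rintegral_stepB_mul z1 a z2 b :
  (\int[lambda]_s ((step z1 s - step a s) * (step z2 s - step b s)) =
  - 2^-1 * (`|z1 - z2| - `|z1 - b| - `|a - z2| + `|a - b|))%R.
Proof.
pose q x y s := ((step x s - step y s) ^+ 2)%R.
have iq x y : lambda.-integrable setT (EFin \o q x y) := integrable_stepB_sqr x y.
transitivity (\int[lambda]_s
    (2^-1 * ((q z1 b s + q a z2 s) - (q z1 z2 s + q a b s))))%R.
  by apply: eq_Rintegral => s _; rewrite /q; field.
have iD x y x' y' : lambda.-integrable setT (EFin \o (fun s => q x y s + q x' y' s)%R).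
  exact: (integrableD measurableT (iq x y) (iq x' y')).
rewrite RintegralZl //; last exact: (integrableB measurableT (iD z1 b a z2) (iD z1 z2 a b)).
rewrite RintegralB // !RintegralD // !Rintegral_stepB_sqr.
by field.
Qed.

(** Each factor keeps the same sign for all levels [s], so the integral of the
absolute value is the absolute value of the integral. *)
Lemma integral_normr_stepB_mul_le z1 a z2 b :
  (\int[lambda]_s `|((step z1 s - step a s) * (step z2 s - step b s))%:E| <=
   `|(2^-1 * (`|z1 - z2| - `|z1 - b| - `|a - z2| + `|a - b|))%R|%:E).
Proof.
pose sg := (Num.sg (z1 - a) * Num.sg (z2 - b))%R.
have i1 := integrable_stepB_mul z1 a z2 b.
have E s : `|((step z1 s - step a s) * (step z2 s - step b s))%:E| =
    sg%:E * ((step z1 s - step a s) * (step z2 s - step b s))%:E.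
  have sgK x y : (`|step x s - step y s| = Num.sg (x - y) * (step x s - step y s))%R.
    rewrite [X in (_ = _ * X)%R]stepB_sgr mulrA -expr2 sqr_sg.
    case: eqP => [/eqP|_]; last by rewrite mul1r.
    by rewrite subr_eq0 => /eqP ->; rewrite subrr normr0 mulr0.
  by rewrite /= -EFinM; congr EFin; rewrite normrM !sgK mulrACA.
under eq_integral do rewrite E.
rewrite integralZl // -EFin_Rintegral // -EFinM lee_fin.
apply: le_trans (ler_norm _) _; rewrite normrM Rintegral_stepB_mul mulNr normrN.
rewrite ler_piMl // /sg normrM mulr_ile1 // normr_sg; by case: (_ != _).
Qed.

End step_functions.

(** * The kernel as a Gram kernel *)
Section kernel.
Context (R : realType) (mu : probability R R).
Local Notation lambda := (@lebesgue_measure R).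
Local Notation Q := (mu \x mu : probability (R * R)%type R).

Definition kernel_integrand (z1 z2 : R) (Z : R * R) : R :=
  (`|z1 - z2| - `|z1 - Z.2| - `|Z.1 - z2| + `|Z.1 - Z.2|)%R.

(** A distribution function taken with weight 1/2 at the jumps differs from
[1 - tail] at the atoms only, that is on a Lebesgue-null set of levels; the
right-continuous version is the one used here. *)
Definition tail (s : R) : R := fine (mu `]s, +oo[%classic).

Definition cstep (x s : R) : R := (step x s - tail s)%R.

Lemma measurable_kernel_integrand z1 z2 :
  measurable_fun setT (kernel_integrand z1 z2).
Proof.
have m1 : measurable_fun setT (fst : R * R -> R) := measurable_fst.
have m2 : measurable_fun setT (snd : R * R -> R) := measurable_snd.
rewrite /kernel_integrand; apply: measurable_funD; first apply: measurable_funB;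
  first apply: measurable_funB; try apply: (measurableT_comp (@normr_measurable _ _)) => //;
  try exact: measurable_funB.
Qed.

(** The Lipschitz constant does not depend on [Z], so the existence of the kernel at
a single point propagates to the whole plane. *)
Lemma kernel_integrand_lipschitz z1 z2 y1 y2 Z :
  (`|kernel_integrand z1 z2 Z - kernel_integrand y1 y2 Z| <=
   2 * (`|z1 - y1| + `|z2 - y2|))%R.
Proof.
case: Z => a b; rewrite /kernel_integrand /=.
have dist (p q r s : R) : (`| `|p - q| - `|r - s| | <= `|p - r| + `|q - s|)%R.
  apply: (le_trans (ler_dist_dist _ _)).
  have -> : (p - q - (r - s) = (p - r) - (q - s))%R by ring.
  exact: ler_normB.
have h1 := dist z1 z2 y1 y2; have h2 := dist z1 b y1 b; have h3 := dist a z2 a y2.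
rewrite !subrr !normr0 ?addr0 ?add0r in h2 h3.
move: h1 h2 h3; rewrite !ler_norml.
move=> /andP[? ?] /andP[? ?] /andP[? ?]; apply/andP; split; lra.
Qed.

Lemma hker_exists_integrable : hker_exists mu ->
  forall z1 z2, Q.-integrable setT (EFin \o kernel_integrand z1 z2).
Proof.
move=> [y1 [y2 hfin]] z1 z2.
have iy : Q.-integrable setT (EFin \o kernel_integrand y1 y2).
  apply/integrableP; split.
    by apply/measurable_EFinP; exact: measurable_kernel_integrand.
  rewrite integral_fin_num_abs //; last exact: measurable_kernel_integrand.
  move: hfin; rewrite /hker -/(kernel_integrand _ _ _) /comp.
  case: (\int[_]_Z _) => [r| |] //.
    by rewrite -EFinN mulr_infty sgrN gtr0_sg // mulN1e.
  by rewrite -EFinN mulr_infty sgrN gtr0_sg // mulN1e.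
pose c := (2 * (`|z1 - y1| + `|z2 - y2|))%R.
have ic : Q.-integrable setT (EFin \o cst c).
  exact: (finite_measure_integrable_cst Q c).
apply: (@integrable_of_le _ _ _ _ _ (fun Z => `|kernel_integrand y1 y2 Z| + c)%R).
- exact: measurable_kernel_integrand.
- exact: (integrableD measurableT (integrable_norm iy) ic).
- move=> Z; have := kernel_integrand_lipschitz z1 z2 y1 y2 Z; rewrite -/c.
  have := lerB_dist (kernel_integrand z1 z2 Z) (kernel_integrand y1 y2 Z).
  by move=> h1 h2; rewrite -lerBlDl; exact: le_trans h1 h2.
Qed.

Lemma tail_ge0 s : (0 <= tail s)%R.
Proof. exact: fine_ge0. Qed.

Lemma tail_le1 s : (tail s <= 1)%R.
Proof.
rewrite -lee_fin /tail fineK ?probability_le1 //.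
by rewrite fin_num_measure.
Qed.

Lemma Rintegral_step (s : R) : (\int[mu]_x step x s = tail s)%R.
Proof.
rewrite /tail /Rintegral -[in RHS](setIT `]s, +oo[%classic) -integral_indic //.
congr fine; apply: eq_integral => x _; congr EFin.
by rewrite indicE mem_setE in_itv /= andbT.
Qed.

Lemma step_integrable (s : R) : mu.-integrable setT (fun x => (step x s)%:E).
Proof.
apply: (integrable_of_bound mu (M := 1)); first exact: measurable_step_point.
by move=> x; rewrite ger0_norm ?step_le1 ?step_ge0.
Qed.

Lemma Rintegral_stepB z s : (\int[mu]_x (step z s - step x s) = cstep z s)%R.
Proof.
rewrite RintegralB ?Rintegral_step //; last exact: step_integrable.
  rewrite Rintegral_cst // [X in (_ * X)%R](_ : _ = 1%R) ?mulr1 //.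
  by rewrite -[RHS]/(fine 1); congr fine; exact: probability_setT.
exact: (finite_measure_integrable_cst mu (step z s)).
Qed.

Lemma measurable_tail : measurable_fun setT tail.
Proof.
have -> : tail = (fun s => \int[mu]_x step x s)%R.
  by apply/funext => s; rewrite Rintegral_step.
have ms : measurable_fun setT (fun z : R * R => (step z.1 z.2)%:E).
  by apply/measurable_EFinP; exact: measurable_step.
have s0 (z : R * R) : 0 <= (step z.1 z.2)%:E by rewrite lee_fin step_ge0.
apply: (measurableT_comp (f := fine)) => //.
exact: (measurable_fun_fubini_tonelli_G _ ms s0).
Qed.

Hypothesis hE : hker_exists mu.

(** By [Rintegral_stepB_mul] the four-term integrand is, up to a factor, an integral
over the levels; [integral_normr_stepB_mul_le] turns its integrability into
joint integrability with respect to the pair and the level, as Fubini requires. *)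
Lemma hkerE z1 z2 : lambda.-integrable setT (fun s => (cstep z1 s * cstep z2 s)%:E) /\
  hker mu z1 z2 = (\int[lambda]_s (cstep z1 s * cstep z2 s))%R%:E.
Proof.
pose G (z : (R * R) * R) : R := ((step z1 z.2 - step z.1.1 z.2) *
  (step z2 z.2 - step z.1.2 z.2))%R.
have mG : measurable_fun setT G.
  have m2 : measurable_fun setT (snd : (R * R) * R -> R) := measurable_snd.
  have m11 : measurable_fun setT (fun z : (R * R) * R => z.1.1).
    exact: (measurableT_comp measurable_fst measurable_fst).
  have m12 : measurable_fun setT (fun z : (R * R) * R => z.1.2).
    exact: (measurableT_comp measurable_snd measurable_fst).
  by apply: measurable_funM; apply: measurable_funB; exact: measurable_step.
have mGE : measurable_fun setT (EFin \o G) by exact/measurable_EFinP.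
have ik := hker_exists_integrable hE z1 z2.
have iG : (Q \x lambda).-integrable setT (EFin \o G).
  apply: (integrable12ltyP Q lambda mGE).2.
  have iA := integrable_norm (integrableZl measurableT 2^-1%R ik).
  move/integrableP : (iA) => [_]; apply: le_lt_trans.
  apply: ge0_le_integral => //.
  - by move=> x _; exact: integral_ge0.
  - have mGa : measurable_fun setT (fun z => `|(EFin \o G) z|).
      exact: measurableT_comp.
    exact: (measurable_fun_fubini_tonelli_F (m2 := lambda) _ mGa).
  - by apply: measurableT_comp => //; exact: measurable_int iA.
  - move=> Z _; apply: (le_trans (integral_normr_stepB_mul_le _ _ _ _)).
    by rewrite /= lee_fin normr_id.
have inner s : \int[Q]_Z (G (Z, s))%:E = (cstep z1 s * cstep z2 s)%:E.
  have mst z : measurable_fun setT (fun x : R => step z s - step x s)%R.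
    by apply: measurable_funB => //; exact: measurable_step_point.
  rewrite -!Rintegral_stepB.
  by apply: (integral_prod_mul mu (M := 1)) => // x; exact: normr_stepB_le1.
have hkE : hker mu z1 z2 = \int[lambda]_s (cstep z1 s * cstep z2 s)%:E.
  transitivity (\int[lambda]_s \int[Q]_Z (EFin \o G) (Z, s)); last first.
    by apply: eq_integral => s _; exact: inner.
  rewrite -(@Fubini _ _ _ _ _ Q lambda _ iG) /hker.
  have -> : - (2^-1)%:E * \int[Q]_Z (kernel_integrand z1 z2 Z)%:E =
      \int[Q]_Z ((- 2^-1)%:E * (kernel_integrand z1 z2 Z)%:E).
    by rewrite integralZl // EFinN.
  apply: eq_integral => Z _; rewrite -EFinM /kernel_integrand -Rintegral_stepB_mul.
  by rewrite EFin_Rintegral //; exact: integrable_stepB_mul.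
have i : lambda.-integrable setT (fun s => (cstep z1 s * cstep z2 s)%:E).
  have mc : measurable_fun setT (fun s => cstep z1 s * cstep z2 s)%R.
    by apply: measurable_funM; apply: measurable_funB;
      [exact: measurable_step_level|exact: measurable_tail
      |exact: measurable_step_level|exact: measurable_tail].
  apply/integrableP; split; first exact/measurable_EFinP.
  rewrite integral_fin_num_abs // -hkE /hker fin_numM //.
  exact: (integrable_fin_num measurableT ik).
by split => //; rewrite EFin_Rintegral.
Qed.

End kernel.

(** * Geometry of the kernel *)
Section kernel_properties.
Context (R : realType) (mu : probability R R).
Local Notation lambda := (@lebesgue_measure R).
Hypothesis hE : hker_exists mu.

Definition rker (z1 z2 : R) : R :=
  (\int[lambda]_s (cstep mu z1 s * cstep mu z2 s))%R.

Lemma hker_rker z1 z2 : hker mu z1 z2 = (rker z1 z2)%:E.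
Proof. by have [] := hkerE hE z1 z2. Qed.

Lemma rkerC z1 z2 : rker z1 z2 = rker z2 z1.
Proof. by apply: eq_Rintegral => s _; rewrite mulrC. Qed.

(** The kernel is a Gram kernel of a map of the line into L^2 whose increments are
differences of step functions: the distance can be read off the kernel. *)
Lemma rker_dist z1 z2 :
  (rker z1 z1 + rker z2 z2 - 2 * rker z1 z2 = `|z1 - z2|)%R.
Proof.
have [i11 _] := hkerE hE z1 z1; have [i22 _] := hkerE hE z2 z2.
have [i12 _] := hkerE hE z1 z2.
rewrite /rker -RintegralD // -RintegralZl // -RintegralB //; last 2 first.
- exact: (integrableD measurableT i11 i22).
- exact: (integrableZl measurableT 2%R i12).
rewrite -Rintegral_stepB_sqr; apply: eq_Rintegral => s _.
by rewrite /cstep; ring.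
Qed.

Lemma normr_cstep_le1 x s : (`|cstep mu x s| <= 1)%R.
Proof.
have := tail_ge0 mu s; have := tail_le1 mu s.
have := step_ge0 x s; have := step_le1 x s.
by rewrite /cstep ler_norml => *; apply/andP; split; lra.
Qed.

Lemma rker_lipschitz z1 z2 y1 y2 :
  (`|rker z1 z2 - rker y1 y2| <= `|z1 - y1| + `|z2 - y2|)%R.
Proof.
have half x x' y : (`|rker x y - rker x' y| <= `|x - x'|)%R.
  have [i _] := hkerE hE x y; have [i' _] := hkerE hE x' y.
  rewrite /rker -RintegralB //.
  have iB := integrableB measurableT i i'.
  apply: (le_trans (le_normr_Rintegral _ _)) => //.
  rewrite -Rintegral_stepB_sqr; apply: le_Rintegral => //.
  - exact: (integrable_norm iB).
  - exact: integrable_stepB_sqr.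
  move=> s _; rewrite -mulrBl normrM.
  have -> : (cstep mu x s - cstep mu x' s = step x s - step x' s)%R.
    by rewrite /cstep; ring.
  by rewrite normr_stepB ler_piMr ?sqr_ge0 // normr_cstep_le1.
have -> : (rker z1 z2 - rker y1 y2 =
    (rker z1 z2 - rker y1 z2) + (rker z2 y1 - rker y2 y1))%R.
  by rewrite (rkerC z2) (rkerC y2); ring.
by apply: (le_trans (ler_normD _ _)); rewrite lerD.
Qed.

End kernel_properties.

Lemma normr_boolB (R : realType) (b : bool) (t : R) :
  (0 <= t -> t <= 1 -> `|b%:R - t| = (1 - 2 * t) * b%:R + t)%R.
Proof.
move=> t0 t1; case: b; rewrite /= ?mulr1n ?mulr0n.
  by rewrite ger0_norm ?subr_ge0 //; ring.
by rewrite sub0r normrN ger0_norm //; ring.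
Qed.

(** Compares [E |b - t|] for a Bernoulli variable [b] of parameter [t], which is
[2 t (1 - t)], with [|b - t|] at either value of [b].  It bounds [(E |u_s|)^2] by a
multiple of the integrand of the kernel at one fixed point. *)
Lemma sqr_boolB_ge (R : realType) (b : bool) (t : R) :
  (0 <= t -> t <= 1 -> (2 * t * (1 - t)) ^+ 2 <= 4 * (b%:R - t) ^+ 2)%R.
Proof.
move=> t0 t1; have -> : (4 * (b%:R - t) ^+ 2 = (2 * (b%:R - t)) ^+ 2)%R by ring.
rewrite -(real_normK (num_real (2 * (b%:R - t)))) lerXn2r ?nnegrE //; first by nra.
rewrite normrM normr_boolB // ger0_norm // -mulrA ler_pM2l //.
by case: b; rewrite /= ?mulr1n ?mulr0n; nra.
Qed.

(** * The centered indicator field of a random variable *)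
Section centered_field.
Context (d : measure_display) (T : measurableType d) (R : realType).
Variables (P : probability T R) (X : {RV P >-> R}).
Local Notation lambda := (@lebesgue_measure R).
Local Notation mu := (distribution P X).

Definition cfield (z : T * R) : R := cstep mu (X z.1) z.2.

Lemma measurable_cfield : measurable_fun setT cfield.
Proof.
have m2 : measurable_fun setT (snd : T * R -> R) := measurable_snd.
have mX : measurable_fun setT X by [].
apply: measurable_funB; last exact: (measurableT_comp (measurable_tail mu) m2).
by apply: measurable_step => //; exact: (measurableT_comp mX measurable_fst).
Qed.

Lemma measurable_step_RV s : measurable_fun setT (fun w => step (X w) s).
Proof. by apply: measurable_step => //; exact: measurable_cst. Qed.

Lemma step_RV_integrable s : P.-integrable setT (fun w => (step (X w) s)%:E).
Proof.
apply: (integrable_of_bound P (M := 1)); first exact: measurable_step_RV.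
by move=> x; rewrite ger0_norm ?step_le1 ?step_ge0.
Qed.

Lemma Rintegral_step_RV s : (\int[P]_w step (X w) s = tail mu s)%R.
Proof.
rewrite /tail /Rintegral /= /distribution /pushforward.
rewrite -[in RHS](setIT (X @^-1` _)%classic) -integral_indic //; last first.
  exact: measurable_funPTI.
congr fine; apply: eq_integral => x _; congr EFin.
by rewrite indicE preimage_itvoy mem_setE.
Qed.

Lemma integral_normr_cfield s :
  \int[P]_w `|cfield (w, s)|%:E = (2 * tail mu s * (1 - tail mu s))%R%:E.
Proof.
have t0 := tail_ge0 mu s; have t1 := tail_le1 mu s.
have i1 := step_RV_integrable s.
have i2 := integrableZl measurableT (1 - 2 * tail mu s)%R i1.
have i3 : P.-integrable setT (EFin \o cst (tail mu s)).
  exact: (finite_measure_integrable_cst P (tail mu s)).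
transitivity (\int[P]_w ((1 - 2 * tail mu s) * step (X w) s + tail mu s)%R%:E).
  by apply: eq_integral => w _; congr EFin; exact: normr_boolB.
rewrite -EFin_Rintegral; last exact: (integrableD measurableT i2 i3).
have Ec : (\int[P]_w cst (tail mu s) w = tail mu s)%R.
  rewrite Rintegral_cst // (_ : fine _ = 1%R) ?mulr1 //.
  by rewrite -[RHS]/(fine 1); congr fine; exact: probability_setT.
by rewrite RintegralD // RintegralZl // Rintegral_step_RV Ec; congr EFin; ring.
Qed.

Hypothesis hE : hker_exists mu.

Lemma admissible_cfield : admissible_field P lambda cfield.
Proof.
split; first exact: measurable_cfield.
- by move=> z; exact: normr_cstep_le1.
- by move=> w; have [] := hkerE hE (X w) (X w).
(* The choice of 0 as the base point is arbitrary. *)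
have [i0 _] := hkerE hE 0%R 0%R.
move/integrableP : (integrableZl measurableT 4%R i0) => [mi0]; apply: le_lt_trans.
rewrite (_ : \int[lambda]_s (\int[P]_w `|cfield (w, s)|%:E) ^+ 2 =
    \int[lambda]_s ((2 * tail mu s * (1 - tail mu s))%R%:E ^+ 2)); last first.
  by apply: eq_integral => s _; congr (_ ^+ 2); exact: integral_normr_cfield.
have mt := measurable_tail mu.
apply: ge0_le_integral => //.
- by move=> s _; rewrite expe_ge0 // lee_fin; have := tail_ge0 mu s; have := tail_le1 mu s; nra.
- under eq_fun do rewrite expe2 -EFinM; apply/measurable_EFinP.
  have mq : measurable_fun setT (fun s => 2 * tail mu s * (1 - tail mu s))%R.
    by apply: measurable_funM; [exact: measurable_funM|exact: measurable_funB].
  exact: measurable_funM.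
- exact: measurableT_comp.
move=> s _; have t0 := tail_ge0 mu s; have t1 := tail_le1 mu s.
rewrite expe2 -!EFinM /= lee_fin; apply: (le_trans _ (ler_norm _)).
by rewrite -!expr2; exact: sqr_boolB_ge.
Qed.

End centered_field.

(** * Zero covariance of all indicators and independence *)
Section independence.
Context (d : measure_display) (T : measurableType d) (R : realType).
Variables (P : probability T R).
Local Notation lambda := (@lebesgue_measure R).
Implicit Types X Y : {RV P >-> R}.

Definition joint_tail X Y (s t : R) : R :=
  (\int[P]_w (step (X w) s * step (Y w) t))%R.

Lemma measurable_step_mul X Y s t :
  measurable_fun setT (fun w => step (X w) s * step (Y w) t)%R.
Proof. by apply: measurable_funM; exact: measurable_step_RV. Qed.

Lemma step_mul_integrable X Y s t :
  P.-integrable setT (fun w => (step (X w) s * step (Y w) t)%:E).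
Proof.
apply: (integrable_of_bound P (M := 1)); first exact: measurable_step_mul.
by move=> x; rewrite ger0_norm ?mulr_ge0 ?mulr_ile1 ?step_le1 ?step_ge0.
Qed.

Lemma joint_tailE X Y s t : (joint_tail X Y s t)%:E =
  P ((X @^-1` `]s, +oo[) `&` (Y @^-1` `]t, +oo[))%classic.
Proof.
rewrite EFin_Rintegral; last exact: step_mul_integrable.
have mA : measurable ((X @^-1` `]s, +oo[) `&` (Y @^-1` `]t, +oo[))%classic.
  by apply: measurableI; exact: measurable_funPTI.
rewrite -[in RHS](setIT (_ `&` _)%classic) -integral_indic //.
apply: eq_integral => x _; congr EFin.
by rewrite indicI /= !indicE !preimage_itvoy !mem_setE.
Qed.

Lemma tailE X s : (tail (distribution P X) s)%:E = P (X @^-1` `]s, +oo[)%classic.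
Proof. by rewrite /tail fineK // fin_num_measure. Qed.

Lemma field_cov_cfield X Y s t : field_cov P (cfield X) (cfield Y) s t =
  (joint_tail X Y s t - tail (distribution P X) s * tail (distribution P Y) t)%R.
Proof.
set p := tail _ s; set q := tail _ t.
have iX := step_RV_integrable X s; have iY := step_RV_integrable Y t.
have iXY := step_mul_integrable X Y s t.
have iqX := integrableZl measurableT q iX.
have ipY := integrableZl measurableT p iY.
have ic : P.-integrable setT (EFin \o cst (p * q)%R).
  exact: (finite_measure_integrable_cst P (p * q)%R).
have Ec : (\int[P]_w cst (p * q) w = p * q)%R.
  rewrite Rintegral_cst // (_ : fine _ = 1%R) ?mulr1 //.
  by rewrite -[RHS]/(fine 1); congr fine; exact: probability_setT.
transitivity (\int[P]_w ((step (X w) s * step (Y w) t - q * step (X w) s) -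
    (p * step (Y w) t - cst (p * q) w)))%R.
  by apply: eq_Rintegral => w _; rewrite /cfield /cstep /= -/p -/q; ring.
have i1 := integrableB measurableT iXY iqX.
have i2 := integrableB measurableT ipY ic.
rewrite RintegralB // RintegralB // RintegralB // Ec !RintegralZl //.
by rewrite !Rintegral_step_RV -/p -/q /joint_tail; ring.
Qed.

Lemma field_covC (u v : T * R -> R) s t :
  field_cov P u v s t = field_cov P v u t s.
Proof. by apply: eq_Rintegral => w _; rewrite mulrC. Qed.

(** Moving the level from [s] to [s'] changes both terms of the covariance, in the
same direction, by at most [P (s < X <= s')]. *)
Lemma field_cov_variation X Y s s' t : (s <= s')%R ->
  (`|field_cov P (cfield X) (cfield Y) s t -
     field_cov P (cfield X) (cfield Y) s' t| <=
   tail (distribution P X) s - tail (distribution P X) s')%R.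
Proof.
move=> ss'; rewrite !field_cov_cfield.
set p := tail _ s; set p' := tail _ s'; set q := tail _ t.
have q0 : (0 <= q)%R := tail_ge0 _ _; have q1 : (q <= 1)%R := tail_le1 _ _.
have iX := step_RV_integrable X s; have iX' := step_RV_integrable X s'.
have iXY := step_mul_integrable X Y s t; have iXY' := step_mul_integrable X Y s' t.
have mono w : (step (X w) s' <= step (X w) s)%R.
  rewrite /step; case sx : (s' < X w)%R; last exact: ler0n.
  by rewrite (le_lt_trans ss' sx).
have p'p : (p' <= p)%R.
  by rewrite /p /p' -!Rintegral_step_RV; apply: le_Rintegral => // w _; exact: mono.
have le1 : (joint_tail X Y s' t <= joint_tail X Y s t)%R.
  by apply: le_Rintegral => // w _; rewrite ler_wpM2r ?step_ge0.
have le2 : (joint_tail X Y s t - joint_tail X Y s' t <= p - p')%R.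
  rewrite /p /p' -!Rintegral_step_RV /joint_tail -!RintegralB //.
  apply: le_Rintegral => //.
  - exact: (integrableB measurableT iXY iXY').
  - exact: (integrableB measurableT iX iX').
  - by move=> w _; rewrite -mulrBl ler_piMr ?step_le1 // subr_ge0.
have le3 : (0 <= (p - p') * q)%R by rewrite mulr_ge0 // subr_ge0.
have le4 : ((p - p') * q <= p - p')%R by rewrite ler_piMr // subr_ge0.
have -> : (joint_tail X Y s t - p * q - (joint_tail X Y s' t - p' * q) =
   (joint_tail X Y s t - joint_tail X Y s' t) - (p - p') * q)%R by ring.
rewrite ler_norml; apply/andP; split.
  rewrite lerBrDr; apply: (@le_trans _ _ 0%R); first by rewrite addrC subr_le0.
  by rewrite subr_ge0.
by rewrite lerBlDr (le_trans le2) // lerDl.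
Qed.

Lemma tail_right_continuous X (s : R) :
  (tail (distribution P X) x @[x --> s^'+] --> tail (distribution P X) s)%classic.
Proof.
apply: fine_cvg; rewrite tailE.
by have := @ccdf_right_continuous _ _ _ P X s; apply.
Qed.

(** If [f s <> 0] then [f] is nonzero on an interval to the right of [s], which is
not a null set. *)
Lemma ae0_of_variation (f p : R -> R) :
  (forall s s', s <= s' -> `|f s - f s'| <= p s - p s')%R ->
  (forall s, (p x @[x --> s^'+] --> p s)%classic) ->
  {ae lambda, forall s, f s = 0%R} -> forall s, f s = 0%R.
Proof.
move=> fp rc f0 s; apply: contrapT => /eqP fs0.
have e0 : (0 < `|f s|)%R by rewrite normr_gt0.
have : (\forall x \near s^'+, p s - p x < `|f s|)%classic%R.
  have /cvgrPdist_lt/(_ _ e0) := rc s.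
  by apply: filterS => x; exact: le_lt_trans (ler_norm _).
move=> /nbhs_ballP[e /= e1 He].
have fne0 x : (s < x < s + e)%R -> f x != 0%R.
  move=> /andP[sx xe]; apply/eqP => fx0.
  have : ball s e x by rewrite /ball /= distrC ger0_norm ?subr_ge0 ?ltW // ltrBlDl.
  move=> /He /(_ sx); apply/negP; rewrite -leNgt.
  by have := fp _ _ (ltW sx); rewrite fx0 subr0.
case: f0 => N [mN N0 fN].
have : lambda `]s, (s + e)%R[%classic <= lambda N.
  apply: le_measure; rewrite ?inE //.
  move=> x /=; rewrite in_itv /= => sxe; apply: fN => /= fx0.
  by have := fne0 _ sxe; rewrite fx0 eqxx.
rewrite [leRHS]N0 lebesgue_measure_itv /= lte_fin ltrDl e1 -EFinB lee_fin.
by rewrite addrC addKr leNgt e1.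
Qed.

Lemma field_cov_eq0 X Y :
  {ae lambda, forall s, {ae lambda, forall t,
    field_cov P (cfield X) (cfield Y) s t = 0%R}} ->
  forall s t, field_cov P (cfield X) (cfield Y) s t = 0%R.
Proof.
move=> D0 s t.
apply: (ae0_of_variation (f := field_cov P (cfield X) (cfield Y) ^~ t)
  (p := tail (distribution P X))).
- by move=> x x' xx'; exact: field_cov_variation.
- exact: tail_right_continuous.
apply: negligibleS D0 => x; apply: contra_not => Dx.
apply: (ae0_of_variation (f := field_cov P (cfield X) (cfield Y) x)
  (p := tail (distribution P Y))) => //.
- by move=> y y' yy'; rewrite 2!(field_covC (cfield X)); exact: field_cov_variation.
- exact: tail_right_continuous.
Qed.

(** Two finite measures that agree on the half-lines, a generating class stable
under intersection, are equal.  Used once for each of the two variables. *)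
Lemma tails_independent_event (E : set T) Y : measurable E ->
  (forall t, P (E `&` Y @^-1` `]t, +oo[)%classic =
             P E * P (Y @^-1` `]t, +oo[)%classic) ->
  forall B, measurable B -> P (E `&` Y @^-1` B)%classic = P E * P (Y @^-1` B)%classic.
Proof.
move=> mE H B mB.
have mY : measurable_fun setT Y by [].
pose m1 : {measure set R -> \bar R} := pushforward (mrestr P mE) Y.
have PE0 : (0 <= fine (P E))%R by exact: fine_ge0.
pose m2 : {measure set R -> \bar R} := mscale (NngNum PE0) (distribution P Y).
have m1E A : m1 mY A = P (E `&` Y @^-1` A)%classic.
  by rewrite /m1 /= /pushforward /mrestr setIC.
have m2E A : m2 A = P E * P (Y @^-1` A)%classic.
  by rewrite /m2 /= /mscale /= fineK // fin_num_measure.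
rewrite -m1E -m2E; move: B mB.
apply: (measure_unique (@RGenOInfty.G R) (fun n => `](- n%:R)%R, +oo[%classic)) => //.
- exact: RGenOInfty.measurableE.
- move=> _ _ [x ->] [y ->]; exists (Num.max x y).
  apply/funext => z; apply/propext; rewrite /= !in_itv /= !andbT gt_max.
  exact: (rwP andP).
- by move=> n; exists (- n%:R)%R.
- apply/seteqP; split => // x _.
  exists (Num.trunc `|x|).+1 => //=; rewrite in_itv /= andbT ltrNl.
  apply: (le_lt_trans (ler_norm _)); rewrite normrN; exact: truncnS_gt.
- by move=> _ [t ->]; rewrite m1E m2E.
- move=> n; rewrite m1E; apply: le_lt_trans (probability_le1 _ _) (ltry 1).
  by apply: measurableI => //; exact: measurable_funPTI.
Qed.

Theorem independent_field_cov X Y :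
  independent_RV P X Y <->
  (forall s t, field_cov P (cfield X) (cfield Y) s t = 0%R).
Proof.
have joint s t : field_cov P (cfield X) (cfield Y) s t = 0%R <->
    P (X @^-1` `]s, +oo[ `&` Y @^-1` `]t, +oo[)%classic =
    P (X @^-1` `]s, +oo[)%classic * P (Y @^-1` `]t, +oo[)%classic.
  rewrite -joint_tailE -!tailE -EFinM field_cov_cfield.
  split=> [/eqP|[->]]; last by rewrite subrr.
  by rewrite subr_eq0 => /eqP ->.
split=> [ind s t|D0].
  by apply/joint; apply: ind.
move=> A B mA mB; apply: tails_independent_event => //.
  exact: measurable_funPTI.
move=> t; rewrite setIC muleC; apply: tails_independent_event => //.
  exact: measurable_funPTI.
by move=> s; rewrite setIC muleC; exact/joint.
Qed.

End independence.

(** * Proportional kernels and linear relations *)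
Section linear_relation.
Context (d : measure_display) (T : measurableType d) (R : realType).
Variables (P : probability T R) (X Y : {RV P >-> R}).

Definition box (x y e : R) : set T :=
  (X @^-1` `](x - e)%R, (x + e)%R[ `&` Y @^-1` `](y - e)%R, (y + e)%R[)%classic.

Lemma measurable_box x y e : measurable (box x y e).
Proof. by apply: measurableI; exact: measurable_funPTI. Qed.

Lemma boxP x y e w : box x y e w <-> (`|X w - x| < e /\ `|Y w - y| < e)%R.
Proof. by rewrite /box /= !in_itv /= -!ltr_distl. Qed.

(** Almost every outcome is mapped by [(X, Y)] into the support of its law: the
complement is covered by the countably many null boxes with rational center and
radius 1/(n+1). *)
Lemma ae_box_gt0 :
  {ae P, forall w, forall e, (0 < e)%R -> 0 < P (box (X w) (Y w) e)}.
Proof.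
pose rbox (i : rat * rat * nat) : set T :=
  box (ratr i.1.1) (ratr i.1.2) (i.2.+1%:R^-1)%R.
pose F k : set T := if unpickle k is Some i then
  (if P (rbox i) == 0 then rbox i else set0) else set0.
have F0 k : P.-negligible (F k).
  rewrite /F; case: unpickle => [i|]; last exact: negligible_set0.
  case: eqP => [P0|_]; last exact: negligible_set0.
  by apply/(negligibleP P _) => //; exact: measurable_box.
apply: negligibleS (negligible_bigcup F0) => w /= /existsNP[e].
move=> /not_implyP[e0 /negP]; rewrite -leNgt => Pe.
have [n _ ne] : exists2 n, True & (n.+1%:R^-1 < e / 2)%R.
  exists (Num.trunc (e / 2)^-1) => //.
  rewrite invf_plt ?posrE ?divr_gt0 //; exact: truncnS_gt.
pose r : R := (n.+1%:R^-1)%R; have r0 : (0 < r)%R by rewrite invr_gt0.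
have near_rat x : exists q : rat, (`|x - ratr q| < r)%R.
  have [|q] := @rat_in_itvoo R (x - r)%R (x + r)%R.
    by rewrite ltrD2l gtrN.
  by rewrite in_itv /= -ltr_distl distrC; exists q.
have [a Xa] := near_rat (X w); have [b Yb] := near_rat (Y w).
pose i : rat * rat * nat := (a, b, n).
exists (pickle i); first exact: I.
rewrite /F pickleK.
have -> : P (rbox i) == 0.
  rewrite -measure_le0; apply: le_trans Pe; apply: le_measure; rewrite ?inE;
    [exact: measurable_box|exact: measurable_box|].
  move=> v /boxP[/= Xv Yv]; apply/boxP; split.
    have := ler_distD (ratr a) (X v) (X w); rewrite (distrC (ratr a) (X w)).
    by rewrite -/r in Xv ne; lra.
  have := ler_distD (ratr b) (Y v) (Y w); rewrite (distrC (ratr b) (Y w)).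
  by rewrite -/r in Yv ne; lra.
by apply/boxP.
Qed.

Hypotheses (hX : hker_exists (distribution P X)).
Hypotheses (hY : hker_exists (distribution P Y)).

Let kX w w' := rker (distribution P X) (X w) (X w').
Let kY w w' := rker (distribution P Y) (Y w) (Y w').

(** An almost sure equality between continuous functions of two independent copies
holds at every pair of support points, since a strict inequality would persist on
a product of two neighbourhoods of positive probability.  The case [w1 = w2] is the
one that the almost sure statement alone does not reach. *)
Lemma proportional_on_support (c : R) w1 w2 :
  {ae P \x P, forall w, kX w.1 w.2 = (c * kY w.1 w.2)%R} ->
  (forall e, (0 < e)%R -> 0 < P (box (X w1) (Y w1) e)) ->
  (forall e, (0 < e)%R -> 0 < P (box (X w2) (Y w2) e)) ->
  kX w1 w2 = (c * kY w1 w2)%R.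
Proof.
move=> [N [mN N0 kN]] P1 P2; apply/eqP; rewrite -subr_eq0; apply/negP => /negP k0.
pose e := `|kX w1 w2 - c * kY w1 w2|%R; have e0 : (0 < e)%R by rewrite normr_gt0.
have c0 : (0 < 2 * (1 + `|c|))%R by rewrite mulr_gt0 // ltr_pwDl.
(* On boxes of radius [r], [kX - c kY] varies by less than [2 (1 + |c|) r]. *)
pose r := (e / (2 * (1 + `|c|)))%R; have r0 : (0 < r)%R by rewrite divr_gt0.
have er : (e = 2 * (1 + `|c|) * r)%R by rewrite mulrC divfK ?gt_eqF.
pose B1 := box (X w1) (Y w1) r; pose B2 := box (X w2) (Y w2) r.
have BN : (B1 `*` B2 `<=` N)%classic.
  move=> [v1 v2] [/= /boxP[x1 y1] /boxP[x2 y2]]; apply: kN => /= kv.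
  have lX := rker_lipschitz hX (X w1) (X w2) (X v1) (X v2).
  have lY := rker_lipschitz hY (Y w1) (Y w2) (Y v1) (Y v2).
  have : (e < e)%R; last by rewrite ltxx.
  rewrite {2}er.
  have -> : e = (`|(kX w1 w2 - kX v1 v2) - c * (kY w1 w2 - kY v1 v2)|)%R.
    by rewrite /e kv; congr (`| _ |)%R; ring.
  apply: (le_lt_trans (ler_normB _ _)); rewrite normrM.
  have {}lX : (`|kX w1 w2 - kX v1 v2| < 2 * r)%R.
    by apply: (le_lt_trans lX); rewrite mulr_natl mulr2n ltrD // distrC.
  have {}lY : (`|kY w1 w2 - kY v1 v2| < 2 * r)%R.
    by apply: (le_lt_trans lY); rewrite mulr_natl mulr2n ltrD // distrC.
  have -> : (2 * (1 + `|c|) * r = 2 * r + `|c| * (2 * r))%R by ring.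
  by apply: ltr_leD lX _; rewrite ler_wpM2l // ltW.
have : (P \x P) (B1 `*` B2)%classic <= (P \x P) N.
  apply: le_measure; rewrite ?inE //.
  by apply: measurableX; exact: measurable_box.
rewrite N0 product_measure1E; [|exact: measurable_box|exact: measurable_box].
by apply/negP; rewrite -ltNge; apply: mule_gt0; [exact: P1|exact: P2].
Qed.

(** A point of a line is determined by its distances to two distinct points.  If [X]
takes two values [x1] and [x2] on [G], subtracting the squared distances of [X] to
these two gives an equation that is linear in both [X] and [Y]. *)
Lemma linear_of_proportional_dist (c : R) (G : set T) :
  {ae P, forall w, G w} ->
  (forall w w', G w -> G w' -> `|X w - X w'| = c * `|Y w - Y w'|)%R ->
  as_linearly_related P X Y.
Proof.
move=> aeG H.
have [[w1 [w2 [G1 G2 X12]]]|Xcst] := pselect (exists w1 w2,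
    [/\ G w1, G w2 & X w1 != X w2]); last first.
  right; exists 0%R; have [[w0 G0]|nG] := pselect (exists w, G w).
    exists (X w0); apply: negligibleS aeG => w; apply: contra_not => /= Gw.
    rewrite mul0r add0r; apply/eqP/negPn/negP => Xw.
    by apply: Xcst; exists w, w0.
  exists 0%R; apply: negligibleS aeG => w; apply: contra_not => /= Gw.
  by case: nG; exists w.
right; set x1 := X w1 in X12; set x2 := X w2 in X12.
have d0 : (x2 - x1 != 0)%R by rewrite subr_eq0 eq_sym.
pose a := (c ^+ 2 * (Y w2 - Y w1) / (x2 - x1))%R.
exists a, ((x1 + x2) / 2 - a * ((Y w1 + Y w2) / 2))%R.
apply: negligibleS aeG => w; apply: contra_not => /= Gw.
have sq v : G v -> ((X w - X v) ^+ 2 = c ^+ 2 * (Y w - Y v) ^+ 2)%R.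
  by move=> Gv; rewrite -[LHS]real_normK ?num_real // H // exprMn real_normK ?num_real.
have := sq _ G1; have := sq _ G2; rewrite -/x1 -/x2 => e2 e1.
apply: (mulfI d0); rewrite mulrDr mulrBr [(_ * (a * _))%R]mulrA.
have -> : ((x2 - x1) * a = c ^+ 2 * (Y w2 - Y w1))%R by rewrite mulrC divfK.
rewrite [((x2 - x1) * (a * _))%R]mulrA.
have -> : ((x2 - x1) * a = c ^+ 2 * (Y w2 - Y w1))%R by rewrite mulrC divfK.
move: (X w) (Y w) (Y w1) (Y w2) (c ^+ 2)%R e1 e2 => x y y1 y2 k e1 e2.
have : ((x - x1) ^+ 2 - (x - x2) ^+ 2 = k * (y - y1) ^+ 2 - k * (y - y2) ^+ 2)%R.
  by rewrite e1 e2.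
by move=> e; clear -e; nra.
Qed.

Theorem linear_of_proportional (c : R) :
  {ae P \x P, forall w, kX w.1 w.2 = (c * kY w.1 w.2)%R} ->
  as_linearly_related P X Y.
Proof.
move=> kc; apply: (linear_of_proportional_dist (c := c) ae_box_gt0) => w w' Gw Gw'.
rewrite -(rker_dist hX) -(rker_dist hY).
rewrite -/(kX w w) -/(kX w' w') -/(kX w w') -/(kY w w) -/(kY w' w') -/(kY w w').
rewrite !(proportional_on_support kc) //.
by ring.
Qed.

End linear_relation.

(** * Affine changes of variable *)
Section affine_transformation.
Context (d : measure_display) (T : measurableType d) (R : realType).
Variables (P : probability T R) (X Y : {RV P >-> R}) (a b : R).
Hypothesis hX : hker_exists (distribution P X).
Hypothesis YX : {ae P, forall w, Y w = (a * X w + b)%R}.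

Let f (x : R) : R := (a * x + b)%R.

Let mf : measurable_fun setT f.
Proof. by apply: measurable_funD => //; exact: measurable_funM. Qed.

Let mf_pre A : measurable A -> measurable (f @^-1` A)%classic.
Proof. by move=> mA; rewrite -[X in measurable X]setTI; exact: mf. Qed.

Lemma distribution_affine A : measurable A ->
  distribution P Y A = distribution P X (f @^-1` A)%classic.
Proof.
move=> mA; have mfA := mf_pre mA.
rewrite /distribution /pushforward.
have mYA : measurable (Y @^-1` A)%classic by exact: measurable_funPTI.
have mXA : measurable (X @^-1` (f @^-1` A))%classic by exact: measurable_funPTI.
rewrite -(setIT (Y @^-1` A)%classic) -(setIT (X @^-1` (f @^-1` A))%classic).
rewrite -!integral_indic //; apply: ge0_ae_eq_integral => //.
- by apply/measurable_EFinP; exact: measurable_indic.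
- by apply/measurable_EFinP; exact: measurable_indic.
apply: negligibleS YX => w; apply: contra_not => /= Yw _.
rewrite !indicE; congr ((nat_of_bool _)%:R%:E).
by apply/idP/idP; rewrite !inE /preimage /= Yw.
Qed.

Theorem hker_affine z1 z2 :
  hker (distribution P Y) (f z1) (f z2) = `|a|%:E * hker (distribution P X) z1 z2.
Proof.
set mu := distribution P X; set nu := distribution P Y.
pose ff (Z : R * R) : R * R := (f Z.1, f Z.2).
have mff : measurable_fun setT ff.
  apply: measurable_fun_pair.
    exact: (measurableT_comp mf measurable_fst).
  exact: (measurableT_comp mf measurable_snd).
have ik := hker_exists_integrable hX z1 z2.
have aff Z : kernel_integrand (f z1) (f z2) (ff Z) = (`|a| * kernel_integrand z1 z2 Z)%R.
  have n x y : (`|f x - f y| = `|a| * `|x - y|)%R.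
    by rewrite -normrM /f; congr (`| _ |)%R; ring.
  by rewrite /kernel_integrand /= !n; ring.
have E : \int[nu \x nu]_Z (kernel_integrand (f z1) (f z2) Z)%:E =
    \int[mu \x mu]_Z (kernel_integrand (f z1) (f z2) (ff Z))%:E.
  pose m' : {measure set (R * R)%type -> \bar R} := pushforward (mu \x mu) ff.
  transitivity (\int[m' mff]_Z (kernel_integrand (f z1) (f z2) Z)%:E).
    apply: eq_measure_integral => A mA _; apply: product_measure_unique => //.
    move=> B C mB mC; rewrite /m' /= /pushforward.
    have -> : (ff @^-1` (B `*` C) = (f @^-1` B) `*` (f @^-1` C))%classic by [].
    rewrite product_measure1E; [|exact: mf_pre|exact: mf_pre].
    by congr (_ * _); apply/esym; exact: distribution_affine.
  rewrite integral_pushforward //.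
  - by apply/measurable_EFinP; exact: measurable_kernel_integrand.
  - have := integrableZl measurableT `|a|%R ik.
    by apply: eq_integrable => // Z _ /=; rewrite -EFinM aff.
rewrite /hker -/(kernel_integrand _ _ _).
rewrite [X in _ * X = _]E.
under eq_integral do rewrite aff EFinM.
by rewrite integralZl // muleCA.
Qed.

End affine_transformation.

(** * The equality case of the Cauchy-Schwarz inequality *)
Section cauchy_schwarz.
Context (d : measure_display) (T : measurableType d) (R : realType).
Variables (mu : {measure set T -> \bar R}) (f g : T -> R).
Hypotheses (mf : measurable_fun setT f) (mg : measurable_fun setT g).
Hypotheses (f2 : mu.-integrable setT (fun x => (f x ^+ 2)%:E)).
Hypotheses (g2 : mu.-integrable setT (fun x => (g x ^+ 2)%:E)).
Local Notation a := (\int[mu]_x f x ^+ 2)%R.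
Local Notation b := (\int[mu]_x g x ^+ 2)%R.
Local Notation k := (\int[mu]_x (f x * g x))%R.
Hypotheses (a0 : (0 < a)%R) (b0 : (0 < b)%R).

Let c := (Num.sqrt a / Num.sqrt b)%R.

(** [c] is the ratio of the norms: this choice makes [f - c g] vanish in mean
square exactly when the Cauchy-Schwarz inequality is an equality. *)
Let cE : (\int[mu]_x (f x + - c * g x) ^+ 2 =
  2 * (Num.sqrt a / Num.sqrt b) * (Num.sqrt (a * b) - k))%R.
Proof.
have [_ ->] := sqr_integrableD (- c)%R mf mg f2 g2.
rewrite sqrtrM ?ltW // /c.
have Ea : a = (Num.sqrt a ^+ 2)%R by rewrite sqr_sqrtr // ltW.
have Eb : b = (Num.sqrt b ^+ 2)%R by rewrite sqr_sqrtr // ltW.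
have : (0 < Num.sqrt b)%R by rewrite sqrtr_gt0.
move: (Num.sqrt a) (Num.sqrt b) Ea Eb => p q -> -> q0.
by field; rewrite gt_eqF.
Qed.

Let c_gt0 : (0 < 2 * (Num.sqrt a / Num.sqrt b))%R.
Proof. by rewrite mulr_gt0 // divr_gt0 // sqrtr_gt0. Qed.

Lemma cauchy_schwarz_le : (k <= Num.sqrt (a * b))%R.
Proof.
have : (0 <= \int[mu]_x (f x + - c * g x) ^+ 2)%R.
  by apply: Rintegral_ge0 => x _; rewrite sqr_ge0.
by rewrite cE pmulr_rge0 // subr_ge0.
Qed.

Lemma cauchy_schwarz_eq : (k = Num.sqrt (a * b))%R ->
  {ae mu, forall x, f x = (Num.sqrt a / Num.sqrt b * g x)%R}.
Proof.
move=> kE; have [i _] := sqr_integrableD (- c)%R mf mg f2 g2.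
have I0 : \int[mu]_x ((f x + - c * g x) ^+ 2)%:E = 0.
  by rewrite -EFin_Rintegral // cE kE subrr mulr0.
have := (ae_eq_integral_abs mu measurableT (measurable_int _ i)).1.
under eq_integral do rewrite gee0_abs ?lee_fin ?sqr_ge0 //.
move=> /(_ I0); apply: filterS => x /= /(_ I) [] /eqP.
by rewrite sqrf_eq0 mulNr subr_eq0 => /eqP.
Qed.

End cauchy_schwarz.

(** * The correlation coefficient *)
Section product_null_sets.
Context (d : measure_display) (T : measurableType d) (R : realType).
Variable P : probability T R.

Lemma ae_prod (A : T -> Prop) : {ae P, forall w, A w} ->
  {ae P \x P, forall w, A w.1 /\ A w.2}.
Proof.
move=> [N [mN N0 AN]].
have mT : measurable [set: T]%classic by exact: measurableT.
have m1 : measurable (N `*` [set: T])%classic by exact: measurableX.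
have m2 : measurable ([set: T] `*` N)%classic by exact: measurableX.
have n1 : (P \x P).-negligible (N `*` [set: T])%classic.
  apply/(negligibleP _ m1); apply: (etrans (product_measure1E P P mN mT)).
  by rewrite [X in X * _](_ : _ = 0) ?mul0e.
have n2 : (P \x P).-negligible ([set: T] `*` N)%classic.
  apply/(negligibleP _ m2); apply: (etrans (product_measure1E P P mT mN)).
  by rewrite [X in _ * X](_ : _ = 0) ?mule0.
apply: negligibleS (negligibleU n1 n2) => -[w1 w2] /= /not_andP[nA|nA].
  by left; split => //; exact: AN.
by right; split => //; exact: AN.
Qed.

Lemma ae_eq_Rintegral (mu : {measure set T -> \bar R}) (f g : T -> R) :
  measurable_fun setT f -> measurable_fun setT g ->
  {ae mu, forall x, f x = g x} -> (\int[mu]_x f x = \int[mu]_x g x)%R.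
Proof.
move=> mf mg fg; congr fine; apply: ae_eq_integral => //.
- exact/measurable_EFinP.
- exact/measurable_EFinP.
by apply: negligibleS fg => x; apply: contra_not => /= -> _.
Qed.

End product_null_sets.

Lemma EFin_div_sqrt (R : realType) (k a b : R) : (0 < a * b)%R ->
  k%:E / sqrte (a%:E * b%:E) = (k / Num.sqrt (a * b))%R%:E.
Proof. by move=> ab0; rewrite -EFinM /= inver gt_eqF ?sqrtr_gt0. Qed.

Section coefficient.
Context (d : measure_display) (T : measurableType d) (R : realType).
Variable P : probability T R.
Local Notation lambda := (@lebesgue_measure R).
Local Notation Q := (P \x P : probability (T * T)%type R).
Implicit Types X Y : {RV P >-> R}.

Definition rv_ker X (w : T * T) : R := rker (distribution P X) (X w.1) (X w.2).

Lemma kappaE X Y : hker_exists (distribution P X) ->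
  hker_exists (distribution P Y) ->
  kappa P X Y = \int[Q]_w (rv_ker X w * rv_ker Y w)%:E.
Proof.
by move=> hX hY; apply: eq_integral => w _; rewrite !hker_rker // -EFinM.
Qed.

Lemma sqr_integrable_cfield X : hker_exists (distribution P X) ->
  kappa P X X < +oo -> sqr_integrable_ker P lambda (cfield X).
Proof.
move=> hX kX; have uA := admissible_cfield hX; split => //.
have mk := measurable_field_ker uA.
apply/integrableP; split.
  by apply/measurable_EFinP; exact: measurable_funX.
move: kX; rewrite kappaE //.
by under [X in _ -> X < _]eq_integral do rewrite gee0_abs ?lee_fin ?sqr_ge0 //.
Qed.

Section two_variables.
Variables X Y : {RV P >-> R}.
Hypotheses (hX : hker_exists (distribution P X))
  (hY : hker_exists (distribution P Y)).
Hypotheses (kX : kappa P X X < +oo) (kY : kappa P Y Y < +oo).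
Hypotheses (kX0 : kappa P X X != 0) (kY0 : kappa P Y Y != 0).

Let a := (\int[Q]_w rv_ker X w ^+ 2)%R.
Let b := (\int[Q]_w rv_ker Y w ^+ 2)%R.
Let k := (\int[Q]_w (rv_ker X w * rv_ker Y w))%R.

Let siX := sqr_integrable_cfield hX kX.
Let siY := sqr_integrable_cfield hY kY.
Let uX : admissible_field P lambda (cfield X) := admissible_cfield hX.
Let uY : admissible_field P lambda (cfield Y) := admissible_cfield hY.
Let mX : measurable_fun setT (rv_ker X) := measurable_field_ker uX.
Let mY : measurable_fun setT (rv_ker Y) := measurable_field_ker uY.
Let iX2 : Q.-integrable setT (fun w => (rv_ker X w ^+ 2)%:E) := siX.2.
Let iY2 : Q.-integrable setT (fun w => (rv_ker Y w ^+ 2)%:E) := siY.2.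
Let iXY : Q.-integrable setT (fun w => (rv_ker X w * rv_ker Y w)%:E) :=
  field_ker_mul_integrable2 siX siY.

Let kappaXX : kappa P X X = a%:E.
Proof. by rewrite (kappaE hX hX); exact/esym/(EFin_Rintegral iX2). Qed.

Let kappaYY : kappa P Y Y = b%:E.
Proof. by rewrite (kappaE hY hY); exact/esym/(EFin_Rintegral iY2). Qed.

Let kappaXY : kappa P X Y = k%:E.
Proof. by rewrite (kappaE hX hY); exact/esym/(EFin_Rintegral iXY). Qed.

Let a_gt0 : (0 < a)%R.
Proof.
rewrite lt_neqAle Rintegral_ge0 ?andbT; last by move=> w _; exact: sqr_ge0.
by apply/eqP => a0; move: kX0; rewrite kappaXX -a0 eqxx.
Qed.

Let b_gt0 : (0 < b)%R.
Proof.
rewrite lt_neqAle Rintegral_ge0 ?andbT; last by move=> w _; exact: sqr_ge0.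
by apply/eqP => b0; move: kY0; rewrite kappaYY -b0 eqxx.
Qed.

Let s_gt0 : (0 < Num.sqrt (a * b))%R.
Proof. by rewrite sqrtr_gt0; exact: mulr_gt0 a_gt0 b_gt0. Qed.

Lemma rho_starE : rho_star P X Y = (k / Num.sqrt (a * b))%R%:E.
Proof.
transitivity (k%:E / sqrte (a%:E * b%:E)).
  by congr (_ / sqrte (_ * _)); [exact: kappaXY|exact: kappaXX|exact: kappaYY].
exact: EFin_div_sqrt (mulr_gt0 a_gt0 b_gt0).
Qed.

Lemma rho_star_bounds : 0 <= rho_star P X Y <= 1.
Proof.
rewrite rho_starE !lee_fin (ler_pdivrMr _ _ s_gt0) mul1r.
apply/andP; split; last exact: (cauchy_schwarz_le mX mY iX2 iY2 a_gt0 b_gt0).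
exact: (divr_ge0 (integral_field_ker_mul_ge0 siX siY) (ltW s_gt0)).
Qed.

Lemma rho_star_eq0 : rho_star P X Y = 0 <-> independent_RV P X Y.
Proof.
rewrite rho_starE independent_field_cov; split=> [[] /eqP|D0].
  rewrite mulf_eq0 invr_eq0 (gt_eqF s_gt0) orbF => /eqP k0.
  exact: field_cov_eq0 (field_cov_ae0 siX siY k0).
by have := integral_field_ker_mul_eq0 siX siY D0; rewrite -/k => ->; rewrite mul0r.
Qed.

Lemma linear_of_rho_star_eq1 : rho_star P X Y = 1 -> as_linearly_related P X Y.
Proof.
rewrite rho_starE => -[] /(canRL (divfK (lt0r_neq0 s_gt0))); rewrite mul1r => ks.
have := cauchy_schwarz_eq mX mY iX2 iY2 a_gt0 b_gt0 ks.
exact: linear_of_proportional.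
Qed.

Lemma rho_star_eq1_of_affine (c e : R) :
  {ae P, forall w, Y w = (c * X w + e)%R} -> rho_star P X Y = 1.
Proof.
move=> YX; rewrite rho_starE.
have prop : {ae Q, forall w, rv_ker Y w = (`|c| * rv_ker X w)%R}.
  apply: negligibleS (ae_prod YX) => w; apply: contra_not => /= -[Y1 Y2].
  apply: (@EFin_inj R); rewrite EFinM /rv_ker -!hker_rker // Y1 Y2.
  exact: hker_affine.
have kE : k = (`|c| * a)%R.
  rewrite /a -RintegralZl //; apply: ae_eq_Rintegral.
  - exact: measurable_funM.
  - by apply: measurable_funM => //; exact: measurable_funX.
  - by apply: negligibleS prop => w; apply: contra_not => /= ->; ring.
have bE : b = (`|c| ^+ 2 * a)%R.
  rewrite /a -RintegralZl //; apply: ae_eq_Rintegral.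
  - exact: measurable_funX.
  - by apply: measurable_funM => //; exact: measurable_funX.
  - by apply: negligibleS prop => w; apply: contra_not => /= ->; ring.
have -> : Num.sqrt (a * b) = (`|c| * a)%R.
  have -> : (a * b = (`|c| * a) ^+ 2)%R by rewrite bE; ring.
  by rewrite sqrtr_sqr; exact: (ger0_norm (mulr_ge0 (normr_ge0 c) (ltW a_gt0))).
have : (`|c| * a != 0)%R.
  by apply/negP => /eqP ca; move: b_gt0; rewrite bE expr2 -mulrA ca mulr0 ltxx.
by rewrite kE => ca; rewrite divff.
Qed.

End two_variables.

Lemma kappaC X Y : kappa P X Y = kappa P Y X.
Proof. by apply: eq_integral => w _; rewrite muleC. Qed.

Lemma rho_starC X Y : rho_star P X Y = rho_star P Y X.
Proof.
transitivity (kappa P Y X / sqrte (kappa P X X * kappa P Y Y)).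
  exact: (congr1 (fun z => z / _) (kappaC X Y)).
exact: (congr1 (fun z => _ / sqrte z) (muleC (kappa P X X) (kappa P Y Y))).
Qed.

End coefficient.

Theorem corollary2 (d : measure_display) (T : measurableType d) (R : realType)
    (P : probability T R) (X Y : {RV P >-> R})
    (hX_exists : hker_exists (distribution P X))
    (hY_exists : hker_exists (distribution P Y))
    (kXX_fin : kappa P X X < +oo) (kYY_fin : kappa P Y Y < +oo)
    (* the denominator of rho_star is nonzero *)
    (kXX_neq0 : kappa P X X != 0) (kYY_neq0 : kappa P Y Y != 0) :
  [/\ 0 <= rho_star P X Y <= 1,
      rho_star P X Y = 0 <-> independent_RV P X Y
    & rho_star P X Y = 1 <-> as_linearly_related P X Y].
Proof.
split; last split.
- exact: (rho_star_bounds hX_exists hY_exists kXX_fin kYY_fin kXX_neq0 kYY_neq0).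
- exact: (rho_star_eq0 hX_exists hY_exists kXX_fin kYY_fin kXX_neq0 kYY_neq0).
- exact: (linear_of_rho_star_eq1
    hX_exists hY_exists kXX_fin kYY_fin kXX_neq0 kYY_neq0).
case=> -[a [b ab]].
  exact: (rho_star_eq1_of_affine
    hX_exists hY_exists kXX_fin kYY_fin kXX_neq0 kYY_neq0 ab).
rewrite rho_starC; exact: (rho_star_eq1_of_affine
    hY_exists hX_exists kYY_fin kXX_fin kYY_neq0 kXX_neq0 ab).
Qed.
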